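(* Let $(V,Y(\cdot,(x,\varphi)),\mathbf{1},\tau)$ be an ($N=1$ Neveu-Schwarz) vertex operator superalgebra over $\bigwedge_*$ with odd formal variables. Let $u,v,w\in V$ with $u$ and $v$ of homogeneous sign, and let $v'\in V'$. (a) (rationality of products) The formal series $\langle v',Y(u,(x_1,\varphi_1))Y(v,(x_2,\varphi_2))w\rangle$, which involves only finitely many negative powers of $x_2$ and only finitely many positive powers of $x_1$, lies in the image of the map $\iota_{12}$: $$\langle v',Y(u,(x_1,\varphi_1))Y(v,(x_2,\varphi_2))w\rangle=\iota_{12}f(x_1,\varphi_1,x_2,\varphi_2),$$ where the (uniquely determined) element $f\in\bigwedge_*[x_1,\varphi_1,x_2,\varphi_2]_{S'}$ is of the form $$f(x_1,\varphi_1,x_2,\varphi_2)=\frac{g(x_1,\varphi_1,x_2,\varphi_2)}{x_1^rx_2^s(x_1-x_2-\varphi_1\varphi_2)^t}$$ for some $g\in\bigwedge_*[x_1,\varphi_1,x_2,\varphi_2]$ and $r,s,t\in\mathbb{Z}$. (b) (supercommutativity) With the same $f$, $$\langle v',Y(v,(x_2,\varphi_2))Y(u,(x_1,\varphi_1))w\rangle=(-1)^{\eta(u)\eta(v)}\iota_{21}f(x_1,\varphi_1,x_2,\varphi_2),$$ i.e. $$\iota_{12}^{-1}\langle v',Y(u,(x_1,\varphi_1))Y(v,(x_2,\varphi_2))w\rangle=(-1)^{\eta(u)\eta(v)}\iota_{21}^{-1}\langle v',Y(v,(x_2,\varphi_2))Y(u,(x_1,\varphi_1))w\rangle.$$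
   Context: **Grassmann algebras and conventions.** $\bigwedge_*$ denotes either $\bigwedge_L$, the exterior algebra over $\mathbb{C}$ of an $L$-dimensional complex vector space $U_L$ ($L\in\mathbb{N}$, $U_L\subset U_{L+1}$), or the direct limit $\bigwedge_\infty$ of the $\bigwedge_L$; it is $\mathbb{Z}_2$-graded, $\bigwedge_*=\bigwedge_*^0\oplus\bigwedge_*^1$. For $a\in\bigwedge_*$, its body $a_B\in\mathbb{C}$ is its component of exterior degree $0$. For a $\mathbb{Z}_2$-graded space, $\eta(v)=i$ for $v$ homogeneous of sign $i\in\{0,1\}$. $[A,B]$ denotes the supercommutator $AB-(-1)^{\eta(A)\eta(B)}BA$ for homogeneous $A,B$. Even formal variables ($x,x_0,x_1,x_2$) commute with everything. Odd formal variables ($\varphi,\varphi_1,\varphi_2$) commute with even variables and with even elements of $\bigwedge_*$ and even operators, anticommute with each other and with odd elements of $\bigwedge_*$ and odd operators, and square to zero. $\delta(x)=\sum_{n\in\mathbb{Z}}x^n$. Expressions such as $(x_1-x_2)^n$, $n\in\mathbb{Z}$, are expanded in nonnegative powers of the second variable, and functions of even and odd variables are expanded about the even variables: $(x_1-x_2-\varphi_1\varphi_2)^n=(x_1-x_2)^n-n\varphi_1\varphi_2(x_1-x_2)^{n-1}$, so $\delta\left(\frac{x_1-x_2-\varphi_1\varphi_2}{x_0}\right)=\sum_{n\in\mathbb{Z}}(x_1-x_2-\varphi_1\varphi_2)^nx_0^{-n}$, and similarly for other such expressions. $Y$ is extended linearly to series with formal-variable coefficients. **Vertex operator superalgebra over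 $\bigwedge_*$ with odd formal variables.** This is a $\frac12\mathbb{Z}$-graded (by weight) $\bigwedge_*$-module, also $\mathbb{Z}_2$-graded (by sign), $V=\coprod_{n\in\frac12\mathbb{Z}}V_{(n)}=\coprod_{n}V^0_{(n)}\oplus\coprod_nV^1_{(n)}=V^0\oplus V^1$, with $\dim V_{(n)}<\infty$ for all $n\in\frac12\mathbb{Z}$ and $V_{(n)}=0$ for $n$ sufficiently small (positive energy), equipped with a linear map $V\otimes V\to V[[x,x^{-1}]][\varphi]$, equivalently $V\to(\mathrm{End}\,V)[[x,x^{-1}]][\varphi]$, $v\mapsto Y(v,(x,\varphi))=\sum_{n\in\mathbb{Z}}v_nx^{-n-1}+\varphi\sum_{n\in\mathbb{Z}}v_{n-\frac12}x^{-n-1}$, where $v_n\in(\mathrm{End}\,V)^{\eta(v)}$ and $v_{n-\frac12}\in(\mathrm{End}\,V)^{(\eta(v)+1)\bmod 2}$ for $v$ of homogeneous sign, and with distinguished vectors $\mathbf{1}\in V^0_{(0)}$ (vacuum) and $\tau\in V^1_{(3/2)}$ (Neveu-Schwarz element), such that for $u,v\in V$: (1) (truncation) $u_nv=0$ for $n\in\frac12\mathbb{Z}$ sufficiently large; (2) $Y(\mathbf{1},(x,\varphi))=1$; (3) (creation) $Y(v,(x,\varphi))\mathbf{1}\in V[[x]][\varphi]$ and $\lim_{(x,\varphi)\to0}Y(v,(x,\varphi))\mathbf{1}=v$; (4) (Jacobi identity) for $u,v$ of homogeneous sign, $$x_0^{-1}\delta\left(\tfrac{x_1-x_2-\varphi_1\varphi_2}{x_0}\right)Y(u,(x_1,\varphi_1))Y(v,(x_2,\varphi_2))-(-1)^{\eta(u)\eta(v)}x_0^{-1}\delta\left(\tfrac{x_2-x_1+\varphi_1\varphi_2}{-x_0}\right)Y(v,(x_2,\varphi_2))Y(u,(x_1,\varphi_1))$$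 $$=x_2^{-1}\delta\left(\tfrac{x_1-x_0-\varphi_1\varphi_2}{x_2}\right)Y(Y(u,(x_0,\varphi_1-\varphi_2))v,(x_2,\varphi_2));$$ (5) (Neveu-Schwarz relations) with $G(n+\frac12)=\tau_{n+1}$ and $2L(n)=\tau_{n+\frac12}$ for $n\in\mathbb{Z}$, one has for $m,n\in\mathbb{Z}$: $[L(m),L(n)]=(m-n)L(m+n)+\frac1{12}(m^3-m)\delta_{m+n,0}(\mathrm{rank}\,V)$, $[G(m+\frac12),L(n)]=(m-\frac{n-1}{2})G(m+n+\frac12)$, $[G(m+\frac12),G(n-\frac12)]=2L(m+n)+\frac13(m^2+m)\delta_{m+n,0}(\mathrm{rank}\,V)$, where $\mathrm{rank}\,V\in\mathbb{C}$; (6) $L(0)v=nv$ for $n\in\frac12\mathbb{Z}$ and $v\in V_{(n)}$; (7) ($G(-\frac12)$-derivative property) $\left(\frac{\partial}{\partial\varphi}+\varphi\frac{\partial}{\partial x}\right)Y(v,(x,\varphi))=Y(G(-\tfrac12)v,(x,\varphi))$. **Graded dual.** $V_{(n)}^*=\mathrm{Hom}_{\bigwedge_*}(V_{(n)},\bigwedge_* )$, $V'=\coprod_{n\in\frac12\mathbb{Z}}V_{(n)}^*$ is the graded dual, and $\langle\cdot,\cdot\rangle$ is the natural pairing of $V'$ with $\prod_nV_{(n)}$, applied coefficientwise to formal series (with the odd formal variables written to the left of the coefficients). **Rational superfunctions and expansion maps.** $\bigwedge_*[x_1,\varphi_1,x_2,\varphi_2]_{S'}$ is the ring obtained from $\bigwedge_*[x_1,x_2][\varphi_1,\varphi_2]$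 by inverting the set $S'$ of all $a_1x_1+a_2x_2+a_{12}\varphi_1\varphi_2$ with $a_1,a_2,a_{12}\in\bigwedge_*^0$ and $(a_1)_B,(a_2)_B$ not both zero. Expanding about the even variables, $\frac{1}{a_1x_1+a_2x_2+a_{12}\varphi_1\varphi_2}=\frac{1}{a_1x_1+a_2x_2}-\frac{a_{12}\varphi_1\varphi_2}{(a_1x_1+a_2x_2)^2}$. The map $\iota_{12}$ sends an element of this ring to a formal series in $\bigwedge_*[[x_1,x_1^{-1},x_2,x_2^{-1}]][\varphi_1,\varphi_2]$ by first expanding in the odd variables as just described and then expanding each term as a series containing at most finitely many negative powers of $x_2$ (binomial expansion of negative powers of linear polynomials involving both $x_1$ and $x_2$). The map $\iota_{21}$ is defined the same way but with at most finitely many negative powers of $x_1$. $\iota_{12}^{-1},\iota_{21}^{-1}$ denote the inverses on the images. *)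

(* Defs.v *)
From HB Require Import structures.
From mathcomp Require Import all_boot all_order all_algebra.
From mathcomp Require Import generic_quotient finmap monalg zify.
From mathcomp Require Import boolp classical_sets functions cardinality fsbigop.
Set Implicit Arguments.
Unset Strict Implicit.
Unset Printing Implicit Defensive.
Import Order.TTheory GRing.Theory Num.Theory.
Local Open Scope classical_set_scope.
Local Open Scope ring_scope.
Local Open Scope quotient_scope.

Section ClassicalInverse.
Variable T : nzRingType.

Definition cl_unit : pred T := fun x => `[< exists y, y * x = 1 /\ x * y = 1 >].

Definition cl_inv (x : T) : T :=
  if pselect (exists y, y * x = 1 /\ x * y = 1) is left ex
  then projT1 (cid ex) else x.

Fact cl_mulVr : {in cl_unit, left_inverse 1 cl_inv *%R}.
Proof.
move=> x /asboolP xU; rewrite /cl_inv; case: pselect => // ex.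
by case: (cid ex) => y [].
Qed.

Fact cl_mulrV : {in cl_unit, right_inverse 1 cl_inv *%R}.
Proof.
move=> x /asboolP xU; rewrite /cl_inv; case: pselect => // ex.
by case: (cid ex) => y [].
Qed.

Fact cl_unitP (x y : T) : y * x = 1 /\ x * y = 1 -> cl_unit x.
Proof. by move=> xy; apply/asboolP; exists y. Qed.

Fact cl_inv_out : {in [predC cl_unit], cl_inv =1 id}.
Proof. by move=> x /asboolP xU; rewrite /cl_inv; case: pselect. Qed.

End ClassicalInverse.

(* The generators of the exterior algebra on L generators (L = Some l), or of
   the direct limit of all of these (L = None), are indexed by the naturals
   below l, respectively by all naturals. *)
Definition is_gen (L : option nat) (i : nat) : bool :=
  if L is Some l then (i < l)%N else true.

Definition gen (L : option nat) := {i : nat | is_gen L i}.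

HB.instance Definition _ L := Choice.on (gen L).

(* Finitely supported functions on finite sets of generators: the coefficient
   a@_A is the one of zeta_A = zeta_i1 ... zeta_ik, for A = {i1 < ... < ik}. *)
Definition grassmann (F : fieldType) (L : option nat) := {malg F[{fset gen L}]}.

Section Grassmann.
Variables (F : fieldType) (L : option nat).
Implicit Types (A B D K : {fset gen L}).

HB.instance Definition _ := GRing.Lmodule.on (grassmann F L).
Implicit Types (a b c : grassmann F L).

(* zeta_A * zeta_B = (-1) ^ crossings A B * zeta_(A u B) for disjoint A, B *)
Definition crossings A B : nat :=
  \sum_(i <- A) \sum_(j <- B) (val j < val i)%N.

Definition gr_mul_coef a b K : F :=
  \sum_(A <- fpowerset K)
     (-1) ^+ crossings A (K `\` A)%fset * (a@_A * b@_(K `\` A)%fset).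

Definition gr_one : grassmann F L := << fset0 >>.

Definition gr_mul a b : grassmann F L :=
  [malg K in [fset (AB.1 `|` AB.2)%fset | AB in
     [seq (A, B) | A <- msupp a, B <- msupp b]]%fset => gr_mul_coef a b K].

Lemma fsetUDK A K : (A `<=` K)%fset -> (A `|` (K `\` A) = K)%fset.
Proof.
move=> /fsubsetP sAK; apply/fsetP => x; rewrite !inE.
by case: (boolP (x \in A)) => //= /sAK ->.
Qed.

Lemma gr_mulE a b K : (gr_mul a b)@_K = gr_mul_coef a b K.
Proof.
rewrite mcoeffE; case: ifPn => // /negP Kab; apply/esym.
rewrite /gr_mul_coef big_seq big1 // => A; rewrite fpowersetE => sAK.
have [Aa|Aa] := boolP (A \in msupp a); last first.
  by rewrite (mcoeff_outdom Aa) mul0r mulr0.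
have [Bb|Bb] := boolP ((K `\` A)%fset \in msupp b); last first.
  by rewrite (mcoeff_outdom Bb) !mulr0.
case: Kab; apply/imfsetP; exists (A, (K `\` A)%fset) => /=.
  by apply/allpairsP; exists (A, (K `\` A)%fset).
by rewrite fsetUDK.
Qed.

Lemma crossings0l A : crossings fset0 A = 0%N.
Proof. by rewrite /crossings big_seq_fset0. Qed.

Lemma crossings0r A : crossings A fset0 = 0%N.
Proof. by rewrite /crossings big1 // => i _; rewrite big_seq_fset0. Qed.

Lemma big_fsetUd (f : gen L -> nat) A B : [disjoint A & B]%fset ->
  (\sum_(i <- (A `|` B)%fset) f i = \sum_(i <- A) f i + \sum_(i <- B) f i)%N.
Proof.
move=> dAB; rewrite -big_cat /=; apply/perm_big/uniq_perm.
- exact: fset_uniq.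
- rewrite cat_uniq !fset_uniq /= andbT; apply/hasPn => x xB.
  by apply: contraL xB; apply: (fdisjointP dAB).
by move=> x; rewrite mem_cat inE.
Qed.

Lemma crossingsUl A B D : [disjoint A & B]%fset ->
  crossings (A `|` B)%fset D = (crossings A D + crossings B D)%N.
Proof. exact: big_fsetUd. Qed.

Lemma crossingsUr A B D : [disjoint A & B]%fset ->
  crossings D (A `|` B)%fset = (crossings D A + crossings D B)%N.
Proof.
move=> dAB; rewrite /crossings -big_split /=.
by apply: eq_bigr => i _; rewrite big_fsetUd.
Qed.

Lemma gr_aux1 (x y z p q r : F) :
  x * y * (p * (z * (q * r))) = x * y * z * (p * q * r).
Proof. by rewrite -!mulrA [p * (z * _)]mulrCA. Qed.

Lemma gr_aux2 (x y z p q r : F) :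
  y * z * (x * (p * q) * r) = x * y * z * (p * q * r).
Proof. by rewrite !mulrA [y * z * x]mulrC !mulrA. Qed.

Lemma gr_mulA : associative gr_mul.
Proof.
move=> a b c; apply/malgP => K; rewrite !gr_mulE /gr_mul_coef.
pose s n : F := (-1) ^+ n.
pose G A B D : F := s (crossings A B) * s (crossings A D) * s (crossings B D) *
  (a@_A * b@_B * c@_D).
transitivity (\sum_(A <- fpowerset K) \sum_(B <- fpowerset (K `\` A)%fset)
   G A B ((K `\` A) `\` B)%fset).
  apply: eq_big_seq => A; rewrite fpowersetE => sAK.
  rewrite gr_mulE /gr_mul_coef !mulr_sumr; apply: eq_big_seq => B.
  rewrite fpowersetE => sB.
  have eU : (B `|` ((K `\` A) `\` B) = K `\` A)%fset.
    by rewrite fsetUDK.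
  have dB : [disjoint B & ((K `\` A) `\` B)]%fset.
    by apply/fdisjointP => x xB; rewrite inE xB.
  rewrite -[X in crossings A X]eU crossingsUr // exprD /G /s.
  exact: gr_aux1.
transitivity (\sum_(B <- fpowerset K) \sum_(A <- fpowerset B)
   G A (B `\` A)%fset (K `\` B)%fset); last first.
  apply: eq_big_seq => B; rewrite fpowersetE => sBK.
  rewrite gr_mulE /gr_mul_coef mulr_suml mulr_sumr; apply: eq_big_seq => A.
  rewrite fpowersetE => sA.
  have eU : (A `|` (B `\` A) = B)%fset.
    by rewrite fsetUDK.
  have dB : [disjoint A & (B `\` A)]%fset.
    by apply/fdisjointP => x xB; rewrite inE xB.
  rewrite -[X in crossings X (K `\` B)%fset]eU crossingsUl // exprD /G /s.
  exact/esym/gr_aux2.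
apply/esym.
transitivity (\sum_(B <- fpowerset K) \sum_(A <- fpowerset K | (A `<=` B)%fset)
   G A (B `\` A)%fset (K `\` B)%fset).
  apply: eq_big_seq => B; rewrite fpowersetE => sBK.
  rewrite -[RHS]big_filter; apply/perm_big/uniq_perm.
  - exact: fset_uniq.
  - by rewrite filter_uniq ?fset_uniq.
  move=> A; rewrite mem_filter !fpowersetE.
  by case: (boolP (A `<=` B)%fset) => //= sAB; rewrite (fsubset_trans sAB).
rewrite (exchange_big_dep xpredT) //=; apply: eq_big_seq => A.
rewrite fpowersetE => sAK.
rewrite -[LHS]big_filter.
transitivity (\sum_(B <- [seq (A `|` D)%fset | D <- fpowerset (K `\` A)%fset])
   G A (B `\` A)%fset (K `\` B)%fset).
  apply/perm_big/uniq_perm.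
  - by rewrite filter_uniq ?fset_uniq.
  - rewrite map_inj_in_uniq ?fset_uniq // => B D.
    rewrite !fpowersetE !fsubsetD => /andP[_ dB] /andP[_ dD] eBD.
    have: ((A `|` B) `\` A = (A `|` D) `\` A)%fset by rewrite eBD.
    by rewrite !fsetDUl fsetDv !fset0U !(fsetDidPl _ _ _).
  move=> B; rewrite mem_filter fpowersetE; apply/andP/mapP.
    case=> sAB sBK; exists (B `\` A)%fset.
      by rewrite fpowersetE fsetSD.
    by rewrite fsetUDK.
  case=> D; rewrite fpowersetE fsubsetD => /andP[sDK dD] ->.
  by rewrite fsubsetUl fsubUset sAK.
rewrite big_map; apply: eq_big_seq => B.
rewrite fpowersetE fsubsetD => /andP[sBK dB].
congr (G _ _ _); last by rewrite fsetDDl.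
by rewrite fsetDUl fsetDv fset0U; apply/fsetDidPl.
Qed.

Lemma gr_mul1 : left_id gr_one gr_mul.
Proof.
move=> a; apply/malgP => K; rewrite gr_mulE /gr_mul_coef.
rewrite (big_fsetD1 fset0) ?fpowersetE ?fsub0set //=.
rewrite crossings0l expr0 mul1r mcoeffU eqxx mul1r fsetD0 big_seq big1 ?addr0 //.
move=> A; rewrite !inE => /andP[A0 _]; rewrite mcoeffU eq_sym (negPf A0).
by rewrite mul0r mulr0.
Qed.

Lemma gr_mulr1 : right_id gr_one gr_mul.
Proof.
move=> a; apply/malgP => K; rewrite gr_mulE /gr_mul_coef.
rewrite (big_fsetD1 K) ?fpowersetE ?fsubset_refl //=.
rewrite fsetDv crossings0r expr0 mul1r mcoeffU eqxx mulr1 big_seq big1 ?addr0 //.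
move=> A; rewrite !inE fpowersetE => /andP[AK sAK]; rewrite mcoeffU.
case: eqP => [e|]; last by rewrite !mulr0.
by case/negP: AK; rewrite eqEfsubset sAK -fsetD_eq0 -e.
Qed.

Lemma gr_mulDl : left_distributive gr_mul +%R.
Proof.
move=> a b c; apply/malgP => K; rewrite mcoeffD !gr_mulE -big_split /=.
by apply: eq_bigr => A _; rewrite mcoeffD mulrDl mulrDr.
Qed.

Lemma gr_mulDr : right_distributive gr_mul +%R.
Proof.
move=> a b c; apply/malgP => K; rewrite mcoeffD !gr_mulE -big_split /=.
by apply: eq_bigr => A _; rewrite mcoeffD !mulrDr.
Qed.

Lemma gr_one_neq0 : gr_one != 0.
Proof.
apply/eqP => /(congr1 (mcoeff fset0)); rewrite mcoeffU eqxx mcoeff0.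
by move/eqP; rewrite oner_eq0.
Qed.

HB.instance Definition _ := GRing.Zmodule_isNzRing.Build (grassmann F L)
  gr_mulA gr_mul1 gr_mulr1 gr_mulDl gr_mulDr gr_one_neq0.

Fact gr_scalerAl (k : F) a b : k *: (a * b) = k *: a * b.
Proof.
apply/malgP => K; rewrite mcoeffZ !gr_mulE /gr_mul_coef mulr_sumr.
by apply: eq_bigr => A _; rewrite mcoeffZ mulrCA !mulrA.
Qed.

HB.instance Definition _ :=
  GRing.Lmodule_isLalgebra.Build F (grassmann F L) gr_scalerAl.

Fact gr_scalerAr (k : F) a b : k *: (a * b) = a * (k *: b).
Proof.
apply/malgP => K; rewrite mcoeffZ !gr_mulE /gr_mul_coef mulr_sumr.
apply: eq_bigr => A _; rewrite mcoeffZ mulrCA; congr (_ * _).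
by rewrite mulrCA.
Qed.

HB.instance Definition _ :=
  GRing.Lalgebra_isAlgebra.Build F (grassmann F L) gr_scalerAr.

HB.instance Definition _ := GRing.NzRing_hasMulInverse.Build (grassmann F L)
  (@cl_mulVr (grassmann F L)) (@cl_mulrV (grassmann F L))
  (@cl_unitP (grassmann F L)) (@cl_inv_out (grassmann F L)).

(* gr_homog i a: a is homogeneous of sign i (false is 0, true is 1) *)
Definition gr_homog (i : bool) : pred (grassmann F L) :=
  fun a => all (fun A => odd #|` A| == i) (msupp a).

Definition gr_body a : F := a@_fset0.

Fact gr_body_is_zmod_morphism : zmod_morphism gr_body.
Proof. by move=> a b; rewrite /gr_body mcoeffB. Qed.

Fact gr_body_is_monoid_morphism : monoid_morphism gr_body.
Proof.
split=> [|a b]; first by rewrite /gr_body mcoeffU eqxx.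
rewrite /gr_body gr_mulE /gr_mul_coef fpowerset0 big_seq_fset1.
by rewrite crossings0l mul1r fsetD0.
Qed.

HB.instance Definition _ :=
  GRing.isZmodMorphism.Build (grassmann F L) F gr_body gr_body_is_zmod_morphism.
HB.instance Definition _ :=
  GRing.isMonoidMorphism.Build (grassmann F L) F gr_body
    gr_body_is_monoid_morphism.

(* The parity automorphism: gr_par a = (-1) ^ i * a for a homogeneous of sign
   i.  Moving a to the right of one odd quantity turns a into gr_par a. *)
Definition gr_par a : grassmann F L :=
  [malg A in msupp a => (-1) ^+ #|` A| * a@_A].

Lemma gr_parE a A : (gr_par a)@_A = (-1) ^+ #|` A| * a@_A.
Proof. by rewrite mcoeffE; case: msuppP; rewrite // mulr0. Qed.

Fact gr_par_is_zmod_morphism : zmod_morphism gr_par.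
Proof.
by move=> a b; apply/malgP => A; rewrite mcoeffB !gr_parE mcoeffB mulrBr.
Qed.

Fact gr_par_is_monoid_morphism : monoid_morphism gr_par.
Proof.
split=> [|a b]; apply/malgP => K; rewrite gr_parE.
  rewrite mcoeffU; case: eqP => [<-|_]; last by rewrite mulr0.
  by rewrite cardfs0 mul1r.
rewrite !gr_mulE /gr_mul_coef mulr_sumr; apply: eq_big_seq => A.
rewrite fpowersetE => sAK; rewrite !gr_parE mulrCA; congr (_ * _).
rewrite -(cardfsID A) (fsetIidPr sAK) exprD -!mulrA; congr (_ * _).
by rewrite mulrCA.
Qed.

HB.instance Definition _ := GRing.isZmodMorphism.Build (grassmann F L)
  (grassmann F L) gr_par gr_par_is_zmod_morphism.
HB.instance Definition _ := GRing.isMonoidMorphism.Build (grassmann F L)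
  (grassmann F L) gr_par gr_par_is_monoid_morphism.

Lemma gr_parK : involutive gr_par.
Proof. by move=> a; apply/malgP => A; rewrite !gr_parE mulrA -expr2 sqrr_sign mul1r. Qed.

Lemma crossingsC A B : [disjoint A & B]%fset ->
  (crossings A B + crossings B A = #|` A| * #|` B|)%N.
Proof.
move=> dAB; rewrite /crossings exchange_big /= -big_split /=.
transitivity (\sum_(j <- B) #|` A|)%N; last first.
  by rewrite big_const_seq count_predT iter_addn_0.
apply: eq_big_seq => j jB; rewrite -big_split /= -sum1_size; apply: eq_big_seq.
move=> i iA; have: val i != val j.
  by apply: contraTneq jB => /val_inj <-; exact: (fdisjointP dAB).
by rewrite neq_ltn; case: ltngtP.
Qed.

Lemma gr_evenC a b : gr_homog false a -> a * b = b * a.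
Proof.
move=> /allP ev; apply/malgP => K; rewrite !gr_mulE /gr_mul_coef.
have KD A : (A `<=` K)%fset -> (K `\` (K `\` A) = A)%fset.
  by move=> sAK; rewrite fsetDK.
transitivity (\sum_(A <- [seq (K `\` A)%fset | A <- fpowerset K])
   (-1) ^+ crossings A (K `\` A)%fset * (a@_A * b@_(K `\` A)%fset)).
  apply/perm_big/uniq_perm.
  - exact: fset_uniq.
  - rewrite map_inj_in_uniq ?fset_uniq // => A B.
    by rewrite !fpowersetE => /KD eA /KD eB e; rewrite -eA e eB.
  move=> A; rewrite fpowersetE; apply/idP/mapP => [sAK|[B _ ->]].
    by exists (K `\` A)%fset; rewrite ?fpowersetE ?fsubsetDl ?KD.
  exact: fsubsetDl.
rewrite big_map; apply: eq_big_seq => A; rewrite fpowersetE => sAK.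
rewrite KD // [b@_A * _]mulrC; set D := (K `\` A)%fset.
have [Da|Da] := boolP (D \in msupp a); last first.
  by rewrite (mcoeff_outdom Da) mul0r !mulr0.
congr (_ * _); apply/eqP; rewrite -signr_odd -[eqbRHS]signr_odd; apply/eqP.
congr (_ ^+ nat_of_bool _).
have dD : [disjoint D & A]%fset by apply/fdisjointP => x; rewrite inE => /andP[].
have := congr1 odd (crossingsC dD).
by rewrite oddD oddM (eqP (ev _ Da)) /=; do 2!case: odd.
Qed.

Lemma gr_par_even a : gr_homog false a -> gr_par a = a.
Proof.
move=> /allP ev; apply/malgP => A; rewrite gr_parE.
have [Aa|Aa] := boolP (A \in msupp a); last by rewrite (mcoeff_outdom Aa) mulr0.
by rewrite -signr_odd (eqP (ev _ Aa)) mul1r.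
Qed.

End Grassmann.

(* Odd2 m m1 m2 m12 stands for m + phi1 m1 + phi2 m2 + phi1 phi2 m12. *)
Record odd2 (M : Type) := Odd2 { oc : M; oc1 : M; oc2 : M; oc12 : M }.

Definition odd2_map (M N : Type) (f : M -> N) (s : odd2 M) : odd2 N :=
  Odd2 (f (oc s)) (f (oc1 s)) (f (oc2 s)) (f (oc12 s)).

Section Odd2Zmodule.

Definition tuple_of_odd2 (M : Type) (s : odd2 M) : M * M * M * M :=
  (oc s, oc1 s, oc2 s, oc12 s).

Definition odd2_of_tuple (M : Type) (s : M * M * M * M) : odd2 M :=
  Odd2 s.1.1.1 s.1.1.2 s.1.2 s.2.

Fact tuple_of_odd2K (M : Type) : cancel (@tuple_of_odd2 M) (@odd2_of_tuple M).
Proof. by case. Qed.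

HB.instance Definition _ (M : choiceType) :=
  Choice.copy (odd2 M) (can_type (@tuple_of_odd2K M)).

Variable M : zmodType.
Implicit Types s t : odd2 M.

Definition odd2_zero : odd2 M := Odd2 0 0 0 0.
Definition odd2_opp : odd2 M -> odd2 M := odd2_map -%R.
Definition odd2_add s t : odd2 M :=
  Odd2 (oc s + oc t) (oc1 s + oc1 t) (oc2 s + oc2 t) (oc12 s + oc12 t).

Fact odd2_addA : associative odd2_add.
Proof. by move=> s t r; rewrite /odd2_add /= !addrA. Qed.
Fact odd2_addC : commutative odd2_add.
Proof.
by move=> [? ? ? ?] [? ? ? ?]; congr Odd2; exact: addrC.
Qed.
Fact odd2_add0 : left_id odd2_zero odd2_add.
Proof. by move=> [? ? ? ?]; rewrite /odd2_add /= !add0r. Qed.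
Fact odd2_addN : left_inverse odd2_zero odd2_opp odd2_add.
Proof. by move=> [? ? ? ?]; rewrite /odd2_add /= !addNr. Qed.

HB.instance Definition _ := GRing.isZmodule.Build (odd2 M)
  odd2_addA odd2_addC odd2_add0 odd2_addN.

Definition oconst (m : M) : odd2 M := Odd2 m 0 0 0.

End Odd2Zmodule.

Section Odd2Ring.
Variables (F : fieldType) (L : option nat).
Local Notation Lam := (grassmann F L).

Definition odd2_scale (V : lmodType Lam) (a : odd2 Lam) (s : odd2 V) : odd2 V :=
  Odd2 (oc a *: oc s)
       (gr_par (oc a) *: oc1 s + oc1 a *: oc s)
       (gr_par (oc a) *: oc2 s + oc2 a *: oc s)
       (oc a *: oc12 s + gr_par (oc1 a) *: oc2 s - gr_par (oc2 a) *: oc1 s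
        + oc12 a *: oc s).

Definition odd2_mul (a b : odd2 Lam) : odd2 Lam :=
  @odd2_scale Lam^o a b.

Implicit Types a b c : odd2 Lam.

Lemma odd2_mulE a b : odd2_mul a b =
  Odd2 (oc a * oc b)
       (gr_par (oc a) * oc1 b + oc1 a * oc b)
       (gr_par (oc a) * oc2 b + oc2 a * oc b)
       (oc a * oc12 b + gr_par (oc1 a) * oc2 b - gr_par (oc2 a) * oc1 b
        + oc12 a * oc b).
Proof. by []. Qed.

Fact odd2_mulA : associative odd2_mul.
Proof.
move=> a b c; rewrite !odd2_mulE /=; congr Odd2.
- exact: mulrA.
- by rewrite rmorphM mulrDr mulrDl !mulrA addrA.
- by rewrite rmorphM mulrDr mulrDl !mulrA addrA.
rewrite !rmorphD !rmorphM /= !gr_parK !mulrDr !mulrDl !mulNr !mulrN.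
rewrite !opprD !mulrA !addrA.
by rewrite [LHS](ACl (1*2*5*3*7*4*6*8*9)) /=.
Qed.

Fact odd2_mul1 : left_id (oconst 1) odd2_mul.
Proof.
move=> [a a1 a2 a12]; rewrite odd2_mulE /= !rmorph1 rmorph0.
by rewrite !mul1r !mul0r subr0 !addr0.
Qed.

Fact odd2_mulr1 : right_id (oconst 1) odd2_mul.
Proof.
by move=> [a a1 a2 a12]; rewrite odd2_mulE /= !mulr1 !mulr0 subr0 addr0 !add0r.
Qed.

Fact odd2_mulDl : left_distributive odd2_mul +%R.
Proof.
move=> a b c; rewrite !odd2_mulE; congr Odd2 => /=.
- by rewrite mulrDl.
- by rewrite rmorphD !mulrDl addrACA.
- by rewrite rmorphD !mulrDl addrACA.
by rewrite !rmorphD !mulrDl opprD !addrA [LHS](ACl (1*3*5*7*2*4*6*8)) /=.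
Qed.

Fact odd2_mulDr : right_distributive odd2_mul +%R.
Proof.
move=> a b c; rewrite !odd2_mulE; congr Odd2 => /=.
- by rewrite mulrDr.
- by rewrite !mulrDr addrACA.
- by rewrite !mulrDr addrACA.
by rewrite !mulrDr opprD !addrA [LHS](ACl (1*3*5*7*2*4*6*8)) /=.
Qed.

Fact odd2_one_neq0 : oconst (1 : Lam) != 0.
Proof. by apply/eqP => /(congr1 (@oc Lam)) /eqP; rewrite oner_eq0. Qed.

HB.instance Definition _ := GRing.Zmodule_isNzRing.Build (odd2 Lam)
  odd2_mulA odd2_mul1 odd2_mulr1 odd2_mulDl odd2_mulDr odd2_one_neq0.

Definition phi1 : odd2 Lam := Odd2 0 1 0 0.
Definition phi2 : odd2 Lam := Odd2 0 0 1 0.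

Definition odd2_body (a : odd2 Lam) : F := gr_body (oc a).

Fact odd2_body_is_zmod_morphism : zmod_morphism odd2_body.
Proof. by move=> a b; exact: (raddfB (@gr_body F L)). Qed.

Fact odd2_body_is_monoid_morphism : monoid_morphism odd2_body.
Proof.
split=> [|a b].
  by rewrite /odd2_body -[1]/(oconst 1) /= rmorph1.
by rewrite /odd2_body -[a * b]/(odd2_mul a b) odd2_mulE /= rmorphM.
Qed.

HB.instance Definition _ := GRing.isZmodMorphism.Build (odd2 Lam) F odd2_body
  odd2_body_is_zmod_morphism.
HB.instance Definition _ := GRing.isMonoidMorphism.Build (odd2 Lam) F odd2_body
  odd2_body_is_monoid_morphism.

End Odd2Ring.

Arguments phi1 {F L}.
Arguments phi2 {F L}.

Record denoms (P : nzRingType) := Denoms {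
  dn_elt :> choiceType;
  dn_val : dn_elt -> P;
  dn_central : forall t p, dn_val t * p = p * dn_val t;
  dn_neq0 : forall l : seq dn_elt, \prod_(t <- l) dn_val t != 0 }.

Section Localization.
Variables (P : nzRingType) (S : denoms P).
Implicit Types (p q : P) (l m n : seq S).

Definition den l : P := \prod_(t <- l) dn_val t.

Lemma den_cat l m : den (l ++ m) = den l * den m.
Proof. exact: big_cat. Qed.

Lemma denC l p : den l * p = p * den l.
Proof.
rewrite /den; elim: l => [|t l IH]; first by rewrite big_nil mul1r mulr1.
by rewrite big_cons -mulrA IH !mulrA dn_central.
Qed.

Lemma den_perm l m : perm_eq l m -> den l = den m.
Proof.
elim: l m => [|t l IH] m lm.
  by move: lm; rewrite perm_sym => /perm_nilP ->.
have tm : t \in m by rewrite -(perm_mem lm) mem_head.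
move: lm; case/splitPr: tm => m1 m2 lm.
have lm' : perm_eq l (m1 ++ m2).
  rewrite -(perm_cons t); apply: (perm_trans lm).
  by rewrite (perm_catCA m1 [:: t] m2).
rewrite den_cat /den !big_cons -!/(den _) (IH _ lm') den_cat.
by rewrite [RHS]mulrA -dn_central mulrA.
Qed.

Lemma den_mul l m p : den l * (den m * p) = den (l ++ m) * p.
Proof. by rewrite den_cat mulrA. Qed.

Lemma den_mull l m p q : den l * p * (den m * q) = den (l ++ m) * (p * q).
Proof. by rewrite -mulrA [p * _]mulrA -[p * den m]denC -!mulrA den_mul. Qed.

(* The pair (p, l) stands for the fraction p / den l. *)
Definition loc_eq (x y : P * seq S) : bool :=
  `[< exists n, den (n ++ y.2) * x.1 = den (n ++ x.2) * y.1 >].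

Fact loc_eq_refl : reflexive loc_eq.
Proof. by move=> x; apply/asboolP; exists [::]. Qed.

Fact loc_eq_sym : symmetric loc_eq.
Proof.
by move=> x y; apply/asboolP/asboolP => -[n e]; exists n; rewrite e.
Qed.

Fact loc_eq_trans : transitive loc_eq.
Proof.
move=> y x z /asboolP[n e] /asboolP[m e']; apply/asboolP.
exists (n ++ m ++ y.2).
rewrite -[LHS]/(den ((n ++ m ++ y.2) ++ z.2) * x.1).
rewrite (@den_perm _ ((m ++ z.2) ++ (n ++ y.2))); last first.
  by apply/permP => a; rewrite !count_cat; lia.
rewrite -den_mul e den_mul (@den_perm _ ((n ++ x.2) ++ (m ++ z.2))); last first.
  by apply/permP => a; rewrite !count_cat; lia.
rewrite -den_mul e' den_mul; congr (_ * _); apply: den_perm.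
by apply/permP => a; rewrite !count_cat; lia.
Qed.

Canonical loc_eq_equiv := EquivRel loc_eq loc_eq_refl loc_eq_sym loc_eq_trans.

Definition loc := {eq_quot loc_eq}.

HB.instance Definition _ : EqQuotient _ loc_eq loc := EqQuotient.on loc.
HB.instance Definition _ := Choice.on loc.

Lemma loc_eqP (x y : P * seq S) :
  reflect (\pi_loc x = \pi_loc y)
    `[< exists n, den (n ++ y.2) * x.1 = den (n ++ x.2) * y.1 >].
Proof. exact: (eqmodP loc_eq x y). Qed.

Lemma loc_eq_cong (p q : P) l m : perm_eq l m -> p = q ->
  \pi_loc (p, l) = \pi_loc (q, m).
Proof.
move=> lm ->; apply/loc_eqP/asboolP; exists [::].
by rewrite /= (den_perm lm).
Qed.

Definition loc_addf (x y : P * seq S) : P * seq S :=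
  (den y.2 * x.1 + den x.2 * y.1, x.2 ++ y.2).
Definition loc_mulf (x y : P * seq S) : P * seq S := (x.1 * y.1, x.2 ++ y.2).
Definition loc_oppf (x : P * seq S) : P * seq S := (- x.1, x.2).

Definition loc_add := lift_op2 loc loc_addf.
Definition loc_mul := lift_op2 loc loc_mulf.
Definition loc_opp := lift_op1 loc loc_oppf.
Definition loc_of (p : P) : loc := \pi_loc (p, [::]).

Lemma loc_repr (x : P * seq S) : exists n,
  den (n ++ (repr (\pi_loc x)).2) * x.1 = den (n ++ x.2) * (repr (\pi_loc x)).1.
Proof. by apply/asboolP/loc_eqP; rewrite reprK. Qed.

Lemma loc_pi_add : {morph \pi : x y / loc_addf x y >-> loc_add x y}.
Proof.
move=> x y; unlock loc_add; apply/loc_eqP/asboolP.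
have [a ea] := loc_repr x; have [b eb] := loc_repr y.
set x' := repr _ in ea *; set y' := repr _ in eb *.
exists (a ++ b); rewrite /= !mulrDr !den_mul; congr (_ + _).
  rewrite (@den_perm _ ((b ++ y'.2 ++ y.2) ++ (a ++ x'.2))); last first.
    by apply/permP => c; rewrite !count_cat; lia.
  rewrite -den_mul ea den_mul; congr (_ * _); apply: den_perm.
  by apply/permP => c; rewrite !count_cat; lia.
rewrite (@den_perm _ ((a ++ x'.2 ++ x.2) ++ (b ++ y'.2))); last first.
  by apply/permP => c; rewrite !count_cat; lia.
rewrite -den_mul eb den_mul; congr (_ * _); apply: den_perm.
by apply/permP => c; rewrite !count_cat; lia.
Qed.
Canonical loc_pi_add_morph := PiMorph2 loc_pi_add.

Lemma loc_pi_mul : {morph \pi : x y / loc_mulf x y >-> loc_mul x y}.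
Proof.
move=> x y; unlock loc_mul; apply/loc_eqP/asboolP.
have [a ea] := loc_repr x; have [b eb] := loc_repr y.
set x' := repr _ in ea *; set y' := repr _ in eb *.
exists (a ++ b) => /=.
rewrite (@den_perm _ ((a ++ x'.2) ++ (b ++ y'.2))); last first.
  by apply/permP => c; rewrite !count_cat; lia.
rewrite -den_mull ea eb den_mull; congr (_ * _); apply: den_perm.
by apply/permP => c; rewrite !count_cat; lia.
Qed.
Canonical loc_pi_mul_morph := PiMorph2 loc_pi_mul.

Lemma loc_pi_opp : {morph \pi : x / loc_oppf x >-> loc_opp x}.
Proof.
move=> x; unlock loc_opp; apply/loc_eqP/asboolP.
by have [a ea] := loc_repr x; exists a; rewrite /= !mulrN ea.
Qed.
Canonical loc_pi_opp_morph := PiMorph1 loc_pi_opp.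

Lemma den_nil p : den [::] * p = p.
Proof. by rewrite /den big_nil mul1r. Qed.

Fact loc_addA : associative loc_add.
Proof.
elim/quotW=> x; elim/quotW=> y; elim/quotW=> z; rewrite !piE /=.
apply: loc_eq_cong; first by rewrite /= catA.
rewrite /= !mulrDr !den_mul addrA; congr (_ * _ + _ * _ + _ * _);
  by apply: den_perm; apply/permP => a; rewrite !count_cat; lia.
Qed.

Fact loc_addC : commutative loc_add.
Proof.
elim/quotW=> x; elim/quotW=> y; rewrite !piE /=; apply: loc_eq_cong.
  by rewrite perm_catC.
by rewrite addrC.
Qed.

Fact loc_add0 : left_id (loc_of 0) loc_add.
Proof.
elim/quotW=> -[p l]; rewrite /loc_of !piE; apply: loc_eq_cong => //=.
by rewrite mulr0 add0r den_nil.
Qed.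

Fact loc_addN : left_inverse (loc_of 0) loc_opp loc_add.
Proof.
elim/quotW=> -[p l]; rewrite /loc_of !piE; apply/loc_eqP/asboolP.
by exists [::]; rewrite /= mulrN addNr !mulr0.
Qed.

HB.instance Definition _ :=
  GRing.isZmodule.Build loc loc_addA loc_addC loc_add0 loc_addN.

Fact loc_mulA : associative loc_mul.
Proof.
elim/quotW=> x; elim/quotW=> y; elim/quotW=> z; rewrite !piE /=.
by apply: loc_eq_cong; rewrite /= ?catA ?mulrA.
Qed.

Fact loc_mul1 : left_id (loc_of 1) loc_mul.
Proof.
elim/quotW=> -[p l]; rewrite /loc_of !piE; apply: loc_eq_cong => //=.
by rewrite mul1r.
Qed.

Fact loc_mulr1 : right_id (loc_of 1) loc_mul.
Proof.
elim/quotW=> -[p l]; rewrite /loc_of !piE; apply: loc_eq_cong => /=.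
  by rewrite cats0.
by rewrite mulr1.
Qed.

Fact loc_mulDl : left_distributive loc_mul loc_add.
Proof.
elim/quotW=> x; elim/quotW=> y; elim/quotW=> z; rewrite !piE /=.
apply/loc_eqP/asboolP; exists [::].
rewrite /= !mulrDl !mulrDr -!mulrA !den_mul; congr (_ * _ + _ * _);
  by apply: den_perm; apply/permP => a; rewrite !count_cat; lia.
Qed.

Fact loc_mulDr : right_distributive loc_mul loc_add.
Proof.
elim/quotW=> x; elim/quotW=> y; elim/quotW=> z; rewrite !piE /=.
apply/loc_eqP/asboolP; exists [::].
rewrite /= !mulrDr ![x.1 * (den _ * _)]mulrA -!denC -!mulrA !den_mul.
by congr (_ * _ + _ * _);
   apply: den_perm; apply/permP => a; rewrite !count_cat; lia.
Qed.

Fact loc_one_neq0 : loc_of 1 != 0.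
Proof.
apply/eqP => /loc_eqP/asboolP[n /=]; rewrite cats0 mulr1 mulr0 => /eqP.
by rewrite (negPf (dn_neq0 n)).
Qed.

HB.instance Definition _ := GRing.Zmodule_isNzRing.Build loc
  loc_mulA loc_mul1 loc_mulr1 loc_mulDl loc_mulDr loc_one_neq0.

HB.instance Definition _ := GRing.NzRing_hasMulInverse.Build loc
  (@cl_mulVr loc) (@cl_mulrV loc) (@cl_unitP loc) (@cl_inv_out loc).

Fact loc_of_is_zmod_morphism : zmod_morphism loc_of.
Proof.
move=> p q; rewrite -[RHS]/(loc_add _ (loc_opp _)) /loc_of !piE.
by apply: loc_eq_cong; rewrite //= !den_nil.
Qed.

Fact loc_of_is_monoid_morphism : monoid_morphism loc_of.
Proof.
split=> // p q; rewrite -[RHS]/(loc_mul _ _) /loc_of !piE.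
exact: loc_eq_cong.
Qed.

HB.instance Definition _ :=
  GRing.isZmodMorphism.Build P loc loc_of loc_of_is_zmod_morphism.
HB.instance Definition _ :=
  GRing.isMonoidMorphism.Build P loc loc_of loc_of_is_monoid_morphism.

End Localization.

(* Generalized binomial coefficients, n * (n - 1) * ... * (n - k + 1) / k!. *)
Definition binz (n : int) (k : nat) : int :=
  match n with
  | Posz m => 'C(m, k)%:Z
  | Negz m => (-1) ^+ k * 'C(m + k, k)%:Z
  end.

Lemma linform_coef01 (T : nzRingType) (a b c : T) :
  (a%:P%:P * 'X%:P + b%:P%:P * 'X + c%:P%:P)`_0`_1 = a.
Proof. by rewrite -polyCM !coefD coefMX !coefC /= ?coef0 coefMX !coefC /= ?coef0 !addr0. Qed.

Lemma linform_coef10 (T : nzRingType) (a b c : T) :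
  (a%:P%:P * 'X%:P + b%:P%:P * 'X + c%:P%:P)`_1`_0 = b.
Proof. by rewrite -polyCM !coefD coefMX !coefC /= ?coefMX ?coefC /= ?coef0 !(addr0, add0r). Qed.

Section Superfunctions.
Variables (F : fieldType) (L : option nat).
Local Notation Lam := (grassmann F L).

(* The even variables commute with everything, so that adjoining them after
   the odd ones gives the same ring.  The inner variable is x1, the outer x2. *)
Definition superpoly := {poly {poly odd2 Lam}}.

HB.instance Definition _ := GRing.NzRing.on superpoly.

Definition sp_const (a : odd2 Lam) : superpoly := a%:P%:P.
Definition sp_x1 : superpoly := 'X%:P.
Definition sp_x2 : superpoly := 'X.

(* The triples (a1, a2, a12) such that a1 x1 + a2 x2 + a12 phi1 phi2 is in S' *)
Definition is_linform (t : Lam * Lam * Lam) : bool :=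
  let: (a1, a2, a12) := t in
  [&& gr_homog false a1, gr_homog false a2, gr_homog false a12
    & (gr_body a1 != 0) || (gr_body a2 != 0)].

Definition linform := {t : Lam * Lam * Lam | is_linform t}.

HB.instance Definition _ := Choice.on linform.

Definition linform_val (t : linform) : superpoly :=
  let: (a1, a2, a12) := val t in
  sp_const (oconst a1) * sp_x1 + sp_const (oconst a2) * sp_x2
  + sp_const (oconst a12 * phi1 * phi2).

Lemma odd2_even_central (a : odd2 Lam) :
  gr_homog false (oc a) -> oc1 a = 0 -> oc2 a = 0 -> gr_homog false (oc12 a) ->
  forall b, a * b = b * a.
Proof.
case: a => a a1 a2 a12 /= ev -> -> ev12 [b b1 b2 b12].
rewrite -[LHS]/(odd2_mul _ _) -[RHS]/(odd2_mul _ _) !odd2_mulE /= rmorph0.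
rewrite (gr_par_even ev) !(mul0r, mulr0, addr0, add0r, subr0).
by congr Odd2; rewrite ?(gr_evenC _ ev) ?(gr_evenC _ ev12) // addrC.
Qed.

Lemma sp_const_central (a : odd2 Lam) :
  (forall b, a * b = b * a) -> forall p : superpoly, sp_const a * p = p * sp_const a.
Proof.
move=> aC p; apply/polyP => i; rewrite coefCM coefMC.
by apply/polyP => j; rewrite coefCM coefMC.
Qed.

Lemma sp_x1_central (p : superpoly) : sp_x1 * p = p * sp_x1.
Proof.
by apply/polyP => i; rewrite coefCM coefMC; exact/esym/commr_polyX.
Qed.

Lemma sp_x2_central (p : superpoly) : sp_x2 * p = p * sp_x2.
Proof. exact/esym/commr_polyX. Qed.

Lemma oconst_phi12 (a : Lam) : oconst a * phi1 * phi2 = Odd2 0 0 0 a.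
Proof.
rewrite -[LHS]/(odd2_mul (odd2_mul _ _) _) !odd2_mulE /= !rmorph0.
by rewrite !(mulr0, mul0r, mulr1, rmorph0, addr0, add0r, subr0) gr_parK.
Qed.

Fact linform_central (t : linform) (p : superpoly) :
  linform_val t * p = p * linform_val t.
Proof.
case: t => [[[a1 a2] a12] /= t]; rewrite /linform_val /= oconst_phi12.
case/and4P: t => ev1 ev2 ev12 _.
have ev0 : gr_homog false (0 : Lam) by apply/allP => A; rewrite -mcoeff_neq0 mcoeff0 eqxx.
rewrite !mulrDl !mulrDr; congr (_ + _ + _).
- rewrite -mulrA sp_x1_central !mulrA; congr (_ * _).
  by apply: sp_const_central; apply: odd2_even_central.
- rewrite -mulrA sp_x2_central !mulrA; congr (_ * _).
  by apply: sp_const_central; apply: odd2_even_central.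
by apply: sp_const_central; apply: odd2_even_central.
Qed.

Definition sp_body (p : superpoly) : {poly {poly F}} :=
  map_poly (map_poly (@odd2_body F L)) p.

Fact linform_prod_neq0 (l : seq linform) : \prod_(t <- l) linform_val t != 0.
Proof.
suff: sp_body (\prod_(t <- l) linform_val t) != 0.
  by apply: contra_neq => ->; rewrite /sp_body rmorph0.
rewrite /sp_body rmorph_prod prodf_seq_neq0; apply/allP => t _ /=.
apply/eqP => /polyP e.
have {}e h k : odd2_body (linform_val t)`_h`_k = 0.
  by have := e h; rewrite coef_map coef0 => /polyP/(_ k); rewrite coef_map coef0.
case: t e => [[[a1 a2] a12] tP] e.
move: (e 0%N 1%N) (e 1%N 0%N); rewrite /linform_val linform_coef01 linform_coef10.
rewrite /odd2_body /= => e1 e2; have /and4P[_ _ _] := tP.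
by rewrite e1 e2 eqxx.
Qed.

Definition linform_denoms : denoms superpoly :=
  Denoms linform_central linform_prod_neq0.

Definition superfun := loc linform_denoms.

HB.instance Definition _ := GRing.UnitRing.on superfun.

Definition sf_of (g : superpoly) : superfun := loc_of linform_denoms g.

(* Formal series in x1, x2, phi1, phi2: the value at (p, q) is the coefficient
   of x1 ^ p x2 ^ q, with the odd variables on the left of the coefficients. *)
Definition ser2 := int * int -> odd2 Lam.

(* The coefficient of y ^ p z ^ q in (b y + c z) ^ n, expanded in nonnegative
   powers of z. *)
Definition lin_pow (b c : Lam) (n p q : int) : Lam :=
  if q is Posz k then
    if p + q == n then b ^ p * c ^+ k *~ binz n k else 0
  else 0.

(* The same for (b y + c z + d phi1 phi2) ^ n, which is
   (b y + c z) ^ n + n d phi1 phi2 (b y + c z) ^ (n - 1). *)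
Definition superlin_pow (b c d : Lam) (n p q : int) : odd2 Lam :=
  Odd2 (lin_pow b c n p q) 0 0 (d * lin_pow b c (n - 1) p q *~ n).

(* The expansions of 1 / (a1 x1 + a2 x2 + a12 phi1 phi2).  If a1 has body zero,
   it is nilpotent, and the expansion in nonnegative powers of x1 is the one with
   finitely many negative powers of x2. *)
Definition iota12_inv_lin (t : linform) : ser2 := fun e =>
  let: (a1, a2, a12) := val t in
  if gr_body a1 != 0 then superlin_pow a1 a2 a12 (-1) e.1 e.2
  else superlin_pow a2 a1 a12 (-1) e.2 e.1.

Definition iota21_inv_lin (t : linform) : ser2 := fun e =>
  let: (a1, a2, a12) := val t in
  if gr_body a2 != 0 then superlin_pow a2 a1 a12 (-1) e.2 e.1
  else superlin_pow a1 a2 a12 (-1) e.1 e.2.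

(* The support of the sum is finite for all the products taken below. *)
Definition ser_mul (s t : ser2) : ser2 := fun e =>
  \sum_(a \in [set: int * int]) s a * t (e - a).

Definition ser_of_poly (g : superpoly) : ser2 := fun e =>
  if e is (Posz p, Posz q) then g`_q`_p else 0.

Definition iota12 (f : superfun) : ser2 :=
  let: (g, l) := repr f in
  foldr (fun t s => ser_mul (iota12_inv_lin t) s) (ser_of_poly g) l.

Definition iota21 (f : superfun) : ser2 :=
  let: (g, l) := repr f in
  foldr (fun t s => ser_mul (iota21_inv_lin t) s) (ser_of_poly g) l.

(* The inverses of the (injective) maps iota12 and iota21 on their images;
   elsewhere the value is the junk value 0. *)
Definition iota12V (s : ser2) : superfun := xget 0 [set f | iota12 f = s].
Definition iota21V (s : ser2) : superfun := xget 0 [set f | iota21 f = s].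

End Superfunctions.

Arguments sp_x1 {F L}.
Arguments sp_x2 {F L}.

(* Half-integers are represented by their doubles: vo_hom k i is the space
   V^i_(k/2), and vo_mode k u v is u_(k/2) v. *)
Record vosa_data (F : fieldType) (L : option nat) := VosaData {
  vo_mod :> lmodType (grassmann F L);
  vo_hom : int -> bool -> set vo_mod;
  vo_mode : int -> vo_mod -> vo_mod -> vo_mod;
  vo_one : vo_mod;
  vo_tau : vo_mod;
  vo_rank : F }.

Arguments vo_hom {F L} v.
Arguments vo_mode {F L} v.
Arguments vo_one {F L} v.
Arguments vo_tau {F L} v.
Arguments vo_rank {F L} v.

Section VosaDefs.
Variables (F : fieldType) (L : option nat) (V : vosa_data F L).
Local Notation Lam := (grassmann F L).

(* V_(k/2) *)
Definition vo_wt (k : int) : set V :=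
  [set v | exists x y, [/\ vo_hom V k false x, vo_hom V k true y & v = x + y]].

(* V^i *)
Definition vo_sgn (i : bool) : set V :=
  [set v | exists c : int -> V, [/\ forall k, vo_hom V k i (c k),
     finite_set [set k | c k != 0] & v = \sum_(k \in [set: int]) c k]].

(* Y(v, (x, phi)) = sum_m x ^ m (vo_Y0 v m + phi vo_Y1 v m) *)
Definition vo_Y0 (v : V) (m : int) : V -> V := vo_mode V (- (m + 1) * 2) v.
Definition vo_Y1 (v : V) (m : int) : V -> V := vo_mode V (- (m + 1) * 2 - 1) v.

(* An operator T of sign i, moved past the odd variables *)
Definition odd2_op (i : bool) (T : V -> V) (s : odd2 V) : odd2 V :=
  Odd2 (T (oc s)) ((-1) ^+ i *: T (oc1 s)) ((-1) ^+ i *: T (oc2 s))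
       (T (oc12 s)).

(* The coefficient of x ^ m in Y(u, (x, phi)) s, for u of sign i and phi an odd
   combination of phi1 and phi2 *)
Definition vo_Y (i : bool) (phi : odd2 Lam) (u : V) (m : int) (s : odd2 V) :
    odd2 V :=
  odd2_op i (vo_Y0 u m) s + odd2_scale phi (odd2_op (~~ i) (vo_Y1 u m) s).

(* The coefficient of x ^ m in Y(s, (x, phi)) w, where Y is extended linearly
   to s in V[phi1, phi2] *)
Definition vo_Ylin (phi : odd2 Lam) (s : odd2 V) (m : int) (w : V) : odd2 V :=
  let Yw v := oconst (vo_Y0 v m w) + odd2_scale phi (oconst (vo_Y1 v m w)) in
  Yw (oc s) + odd2_scale phi1 (Yw (oc1 s)) + odd2_scale phi2 (Yw (oc2 s))
  + odd2_scale (phi1 * phi2) (Yw (oc12 s)).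

(* For u and v of signs i and j, the coefficients of x1 ^ p x2 ^ q in
   Y(u, (x1, phi1)) Y(v, (x2, phi2)) w and Y(v, (x2, phi2)) Y(u, (x1, phi1)) w,
   and that of x0 ^ p x2 ^ q in Y(Y(u, (x0, phi1 - phi2)) v, (x2, phi2)) w *)
Definition vo_prod12 (i j : bool) (u v w : V) (e : int * int) : odd2 V :=
  vo_Y i phi1 u e.1 (vo_Y j phi2 v e.2 (oconst w)).
Definition vo_prod21 (i j : bool) (u v w : V) (e : int * int) : odd2 V :=
  vo_Y j phi2 v e.2 (vo_Y i phi1 u e.1 (oconst w)).
Definition vo_iter (i : bool) (u v w : V) (e : int * int) : odd2 V :=
  vo_Ylin phi2 (vo_Y i (phi1 - phi2) u e.1 (oconst v)) e.2 w.

(* Series in x0, x1, x2 with exponents (e0, e1, e2) *)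
Local Notation exp3 := (int * int * int)%type.

(* x0^-1 delta((x1 - x2 - phi1 phi2) / x0) *)
Definition delta12 (e : exp3) : odd2 Lam :=
  let: (e0, e1, e2) := e in superlin_pow 1 (-1) (-1) (- e0 - 1) e1 e2.
(* x0^-1 delta((x2 - x1 + phi1 phi2) / - x0) *)
Definition delta21 (e : exp3) : odd2 Lam :=
  let: (e0, e1, e2) := e in
  superlin_pow 1 (-1) 1 (- e0 - 1) e2 e1 *~ (-1) ^ (- e0 - 1).
(* x2^-1 delta((x1 - x0 - phi1 phi2) / x2) *)
Definition delta10 (e : exp3) : odd2 Lam :=
  let: (e0, e1, e2) := e in superlin_pow 1 (-1) (-1) (- e2 - 1) e1 e0.

Definition ser_x1x2 (s : int * int -> odd2 V) (e : exp3) : odd2 V :=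
  let: (e0, e1, e2) := e in if e0 == 0 then s (e1, e2) else 0.
Definition ser_x0x2 (s : int * int -> odd2 V) (e : exp3) : odd2 V :=
  let: (e0, e1, e2) := e in if e1 == 0 then s (e0, e2) else 0.

(* The truncation property makes the support of the sum finite for the three
   products in the Jacobi identity. *)
Definition ser_act (d : exp3 -> odd2 Lam) (s : exp3 -> odd2 V) (e : exp3) :
    odd2 V :=
  \sum_(a \in [set: exp3]) odd2_scale (d a) (s (e - a)).

(* G(n + 1/2) and L(n) *)
Definition vo_G (n : int) : V -> V := vo_mode V ((n + 1) * 2) (vo_tau V).
Definition vo_L (n : int) (v : V) : V :=
  (2%:R^-1 : F)%:A *: vo_mode V (n * 2 + 1) (vo_tau V) v.

(* The linearity over the Grassmann algebra follows the rule of signs. *)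
Record is_vosa : Prop := IsVosa {
  vo_hom0 : forall k i, vo_hom V k i 0;
  vo_homD : forall k i x y,
    vo_hom V k i x -> vo_hom V k i y -> vo_hom V k i (x + y);
  vo_homZ : forall k i j a x,
    gr_homog j a -> vo_hom V k i x -> vo_hom V k (i (+) j) (a *: x);
  vo_direct : forall v, exists! c : int * bool -> V,
    [/\ forall e, vo_hom V e.1 e.2 (c e), finite_set [set e | c e != 0]
      & v = \sum_(e \in [set: int * bool]) c e];
  vo_finite : forall k, exists2 s : seq V, (forall x, x \in s -> vo_wt k x)
    & forall v, vo_wt k v ->
      exists c : 'I_(size s) -> Lam, v = \sum_(h < size s) c h *: s`_h;
  vo_positive : exists N : int, forall k, (k < N)%R -> vo_wt k `<=` [set 0];
  vo_modeDl : forall k u v w,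
    vo_mode V k (u + v) w = vo_mode V k u w + vo_mode V k v w;
  vo_modeDr : forall k u v w,
    vo_mode V k u (v + w) = vo_mode V k u v + vo_mode V k u w;
  vo_Y0Zl : forall m a u v, vo_Y0 (a *: u) m v = a *: vo_Y0 u m v;
  vo_Y1Zl : forall m a u v, vo_Y1 (a *: u) m v = gr_par a *: vo_Y1 u m v;
  vo_Y0Zr : forall m i j a u v, vo_sgn i u -> gr_homog j a ->
    vo_Y0 u m (a *: v) = (-1) ^+ (i && j) *: (a *: vo_Y0 u m v);
  vo_Y1Zr : forall m i j a u v, vo_sgn i u -> gr_homog j a ->
    vo_Y1 u m (a *: v) = (-1) ^+ (~~ i && j) *: (a *: vo_Y1 u m v);
  vo_Y0_sgn : forall m i j u v, vo_sgn i u -> vo_sgn j v ->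
    vo_sgn (i (+) j) (vo_Y0 u m v);
  vo_Y1_sgn : forall m i j u v, vo_sgn i u -> vo_sgn j v ->
    vo_sgn (~~ i (+) j) (vo_Y1 u m v);
  vo_one_hom : vo_hom V 0 false (vo_one V);
  vo_tau_hom : vo_hom V 3 true (vo_tau V);
  vo_truncation : forall u v, exists N : int,
    forall k, (N <= k)%R -> vo_mode V k u v = 0;
  vo_vacuum0 : forall m v, vo_Y0 (vo_one V) m v = if m == 0 then v else 0;
  vo_vacuum1 : forall m v, vo_Y1 (vo_one V) m v = 0;
  vo_creation : forall v m, (m < 0)%R ->
    vo_Y0 v m (vo_one V) = 0 /\ vo_Y1 v m (vo_one V) = 0;
  vo_creation_lim : forall v, vo_Y0 v 0 (vo_one V) = v;
  vo_jacobi : forall i j u v w, vo_sgn i u -> vo_sgn j v -> forall e,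
    ser_act delta12 (ser_x1x2 (vo_prod12 i j u v w)) e
    - ser_act delta21 (ser_x1x2 (vo_prod21 i j u v w)) e *~ (-1) ^+ (i && j)
    = ser_act delta10 (ser_x0x2 (vo_iter i u v w)) e;
  vo_LL : forall m n v,
    vo_L m (vo_L n v) - vo_L n (vo_L m v) =
    vo_L (m + n) v *~ (m - n)
    + (12%:R^-1 * (m ^+ 3 - m)%:~R * (m + n == 0)%:R * vo_rank V)%:A *: v;
  vo_GL : forall m n v,
    vo_G m (vo_L n v) - vo_L n (vo_G m v) =
    (m%:~R - (n - 1)%:~R / 2%:R : F)%:A *: vo_G (m + n) v;
  vo_GG : forall m n v,
    vo_G m (vo_G (n - 1) v) + vo_G (n - 1) (vo_G m v) =
    vo_L (m + n) v *+ 2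
    + (3%:R^-1 * (m ^+ 2 + m)%:~R * (m + n == 0)%:R * vo_rank V)%:A *: v;
  vo_L0 : forall k v, vo_wt k v -> vo_L 0 v = (k%:~R / 2%:R : F)%:A *: v;
  (* the odd derivative of a + phi b is b + phi (d/dx) a *)
  vo_deriv0 : forall v m w, vo_Y0 (vo_G (-1) v) m w = vo_Y1 v m w;
  vo_deriv1 : forall v m w,
    vo_Y1 (vo_G (-1) v) m w = vo_Y0 v (m + 1) w *~ (m + 1) }.

End VosaDefs.

Record vosa (F : fieldType) (L : option nat) := Vosa {
  vo_data :> vosa_data F L;
  vo_axioms : is_vosa vo_data }.

(* A finitely supported family of functionals on the V_(k/2) amounts to a
   functional on V that vanishes on V_(k/2) for almost all k. *)
Record graded_dual (F : fieldType) (L : option nat) (V : vosa_data F L) :=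
  GradedDual {
    gd_fun :> {linear V -> (grassmann F L)^o};
    gd_finite : finite_set [set k | exists2 v, vo_wt k v & gd_fun v != 0] }.

Definition pairing (F : fieldType) (L : option nat) (V : vosa_data F L)
    (v' : graded_dual V) (s : int * int -> odd2 V) : ser2 F L :=
  fun e => odd2_map (fun v => v' v : grassmann F L) (s e).

(* Main.v *)
Require Import Defs.
From mathcomp Require Import all_boot all_order all_algebra.
From mathcomp Require Import finmap generic_quotient monalg zify ring.
From mathcomp Require Import cardinality fsbigop.
From mathcomp Require Import boolp classical_sets reals complex.
Set Implicit Arguments.
Unset Strict Implicit.
Unset Printing Implicit Defensive.
Import Order.TTheory GRing.Theory Num.Theory.
Local Open Scope ring_scope.

(** Why the theorem is true.  Since Y(u, (x0, phi)) v has only finitely many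
    negative powers of x0, the coefficient of x0 ^ (- n - 1) on the right-hand
    side of the Jacobi identity vanishes for n large.  On the left-hand side it
    is the difference of (x1 - x2 - phi1 phi2) ^ n times the two products, so
    that both products become equal up to sign after multiplication by a power
    of x1 - x2 - phi1 phi2 ([weak_supercommutativity]).  Paired with v', one of
    them has bounded positive powers of x1 and bounded negative powers of x2,
    the other one bounded positive powers of x2 and bounded negative powers of
    x1 ([pair_YY_vanish]).  The common multiple satisfies all four bounds,
    hence is a Laurent polynomial, and dividing it by the power of
    x1 - x2 - phi1 phi2 gives f ([rational_of_common_multiple]).

    The bound on the positive powers comes from the grading: the coefficient of
    x ^ p in Y(u, (x, 0)) raises weights by wt u + p, the weights of V are
    bounded below, and v' vanishes on all large weights.  This effect on
    weights is a consequence of the axioms.  The coefficient of phi1 in the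
    Jacobi identity for tau and v is the commutator of L(0) with the even
    modes of v ([tau_commutator]); it involves L(-1) v, and the relation
    G(-1/2) ^ 2 = L(-1) together with the derivative property turns this term
    into a derivative.  A vector is homogeneous as soon as it is an eigenvector
    of L(0) for a half-integer, because the eigenvalues of L(0) on the
    homogeneous subspaces are distinct.

    The other half of the argument concerns the expansion maps.  Call a series
    conical if its exponents are bounded above in one variable and below in the
    other.  Convolution of conical series is well defined, and in it every
    linear form of S' is inverted by its prescribed expansion
    ([lin_act_expand_inv]): if the coefficient of the leading variable has body
    zero it is nilpotent, so that expanding in its nonnegative powers gives a
    series that is finite in the relevant direction.  Hence the expansion of
    g / d is the unique conical series S with d S = g ([expand_sfrac],
    [expandP]).  This makes the expansion independent of the representing
    fraction, proves that it is injective, and allows both expansions of f to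
    be recognized from the equation d S = g alone. *)

(** * Units of Grassmann algebras *)

Lemma scalarM (R : nzRingType) (A : lalgType R) (c d : R) :
  c%:A * d%:A = (c * d)%:A :> A.
Proof. by rewrite -scalerAl mul1r scalerA. Qed.

(** The geometric series of d terminates. *)
Lemma unit_sub_nilpotent (R : unitRingType) (d : R) n :
  d ^+ n = 0 -> 1 - d \is a GRing.unit.
Proof.
move=> dn; have e : (1 - d) * (\sum_(i < n) d ^+ i) = 1.
  by rewrite -[1 - d]opprB mulNr -subrX1 dn sub0r opprK.
apply/unitrP; exists (\sum_(i < n) d ^+ i); split=> //; rewrite -{2}e.
apply/commr_sym/commr_sum => i _; apply/commrX/commr_sym.
by apply: commrB; [exact: commr1|].
Qed.

Section GrassmannUnits.
Variables (F : fieldType) (L : option nat).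
Local Notation Lam := (grassmann F L).
Implicit Types a b : Lam.

Lemma gr_mcoeffM a b K : (a * b)@_K = gr_mul_coef a b K.
Proof. exact: gr_mulE. Qed.

(** A body-zero element only involves nonempty monomials, and a product of n
    nonempty monomials in the generators that occur in a has degree at least n. *)
Lemma mcoeff_exp_body0 a n K : gr_body a = 0 ->
  (a ^+ n)@_K != 0 ->
  (K `<=` \bigcup_(A <- msupp a) A)%fset && (n <= #|` K|)%N.
Proof.
move=> a0; elim: n K => [|n IH] K.
  rewrite expr0 leq0n andbT mcoeffU.
  by case: (fset0 =P K) => [<-|_]; rewrite ?fsub0set ?eqxx.
rewrite exprS gr_mcoeffM /gr_mul_coef => nz.
have [A sAK /andP[aA aD]] : exists2 A, A \in fpowerset K &
    (a@_A != 0) && ((a ^+ n)@_(K `\` A)%fset != 0).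
  apply: contraNP nz => noA; rewrite big_seq big1 // => A AK.
  have [->|aA] := eqVneq a@_A 0; first by rewrite mul0r mulr0.
  have [->|aD] := eqVneq (a ^+ n)@_(K `\` A)%fset 0; first by rewrite !mulr0.
  by case: noA; exists A; rewrite // aA.
rewrite fpowersetE in sAK; have /andP[sD cD] := IH _ aD.
have A0 : (0 < #|` A|)%N.
  rewrite cardfs_gt0; apply: contraNneq aA => ->.
  by apply/eqP.
apply/andP; split.
  rewrite -(fsetUDK sAK) fsubUset sD andbT.
  by apply: bigfcup_sup; rewrite // -mcoeff_neq0.
by rewrite -(cardfsID A) (fsetIidPr sAK) -addn1 addnC leq_add.
Qed.

Lemma gr_body0_nilpotent a : gr_body a = 0 -> exists n, a ^+ n = 0.
Proof.
move=> a0; exists (#|` \bigcup_(A <- msupp a) A|%fset).+1.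
apply/malgP => K; rewrite mcoeff0; apply/eqP/negP => /negP nz.
have /andP[/fsubset_leq_card sK cK] := mcoeff_exp_body0 a0 nz.
by have := leq_trans cK sK; rewrite ltnn.
Qed.

Lemma gr_body_unit a : gr_body a != 0 -> a \is a GRing.unit.
Proof.
set k := gr_body a => k0.
pose d : Lam := 1 - k^-1 *: a.
have [n dn] : exists n, d ^+ n = 0.
  apply: gr_body0_nilpotent.
  by rewrite /gr_body mcoeffB mcoeffZ mcoeffU eqxx mulVf ?subrr.
have -> : a = k%:A * (1 - d).
  by rewrite mulr_algl opprB addrCA subrr addr0 scalerA divff ?scale1r.
rewrite unitrMr; first exact: unit_sub_nilpotent dn.
apply/unitrP; exists (k^-1)%:A; rewrite !scalarM.
by rewrite mulVf // divff // !scale1r.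
Qed.

Lemma gr_homogN i (a : Lam) : gr_homog i a -> gr_homog i (- a).
Proof.
by move=> /allP h; apply/allP => A; rewrite -mcoeff_neq0 mcoeffN oppr_eq0 mcoeff_neq0 => /h.
Qed.

Lemma gr_homog0 i : gr_homog i (0 : Lam).
Proof. by apply/allP => A; rewrite -mcoeff_neq0 mcoeff0 eqxx. Qed.

Lemma gr_homogC (c : F) : gr_homog false (c%:A : Lam).
Proof.
apply/allP => A; rewrite -mcoeff_neq0 mcoeffZ mcoeffU.
by case: (fset0 =P A) => [<-|_]; rewrite ?mulr0 ?eqxx // cardfs0.
Qed.

Lemma gr_homog1 : gr_homog false (1 : Lam).
Proof. by have := gr_homogC 1; rewrite scale1r. Qed.

End GrassmannUnits.

(** * Powers of linear forms *)

Lemma binz0 n : binz n 0 = 1.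
Proof. by case: n => m; rewrite /= ?bin0 // expr0 mul1r bin0. Qed.

Lemma binz_pascal n k : binz (n + 1) k.+1 = binz n k.+1 + binz n k.
Proof.
case: n => [m|[|m]].
- by rewrite -PoszD addn1 /= binS PoszD.
- rewrite (_ : Negz 0 + 1 = 0) // /= !add0n !binn bin0n !mulr1 exprS.
  by rewrite mulN1r addNr.
rewrite (_ : Negz m.+1 + 1 = Negz m) /=; last by lia.
rewrite [(m.+1 + _)%N]addnS binS PoszD exprS addSnnS; ring.
Qed.

Lemma binz_small (n k : nat) : (n < k)%N -> binz n k = 0.
Proof. by move=> nk; rewrite /= bin_small. Qed.

Section SuperPowers.
Variables (F : fieldType) (L : option nat).
Local Notation Lam := (grassmann F L).
Local Notation T := (odd2 Lam).
Implicit Types (b c d : Lam) (n p q : int).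

Lemma lin_pow_neg b c n p k : lin_pow b c n p (Negz k) = 0.
Proof. by []. Qed.

(** Pascal's rule, in the form that is used below: the expansion of
    (b y + c z) ^ n, for any integer n, is multiplied by b y + c z when n
    increases by 1.  For n = -1 it says that the expansion of the inverse is an
    inverse. *)
Lemma lin_powS b c n p q : b \is a GRing.unit -> GRing.comm b c ->
  lin_pow b c (n + 1) p q = b * lin_pow b c n (p - 1) q + c * lin_pow b c n p (q - 1).
Proof.
move=> bU bc.
have bS : b * b ^ (p - 1) = b ^ p by rewrite -{1}[b]expr1z -exprzDr // addrC subrK.
have cb : c * b ^ p = b ^ p * c by apply/commrXz/commr_sym.
case: q => [[|k]|k]; last first.
- by rewrite (_ : Negz k - 1 = Negz k.+1) /= ?mulr0 ?addr0 //; lia.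
- rewrite (_ : k.+1%:Z - 1 = k) /=; last by lia.
  rewrite (_ : (p - 1 + k.+1 == n) = (p + k.+1 == n + 1)); last by lia.
  rewrite (_ : (p + k == n) = (p + k.+1 == n + 1)); last by lia.
  case: ifP => _; last by rewrite !mulr0 addr0.
  by rewrite binz_pascal mulrzDr !mulrzAr !mulrA bS cb exprS mulrA.
rewrite (_ : 0%:Z - 1 = Negz 0) // lin_pow_neg mulr0 addr0 /=.
rewrite (_ : (p - 1 + 0 == n) = (p + 0 == n + 1)); last by lia.
case: ifP => _; last by rewrite mulr0.
by rewrite !binz0 !mulr1 bS.
Qed.

Lemma lin_pow0 b c p q : lin_pow b c 0 p q = ((p, q) == (0, 0))%:R.
Proof.
rewrite xpair_eqE; case: q => [[|k]|k] //=; last by rewrite andbF.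
  by rewrite addr0 andbT; case: (p =P 0) => [->|_] //=; rewrite !mulr1.
by rewrite bin0n mulr0z if_same andbF.
Qed.

Lemma lin_pow_small b c n p q : (n < p) || (q < 0) -> lin_pow b c n p q = 0.
Proof.
case: q => [k|//]; rewrite /lin_pow orbF => np.
by case: ifP => // /eqP; lia.
Qed.

Lemma lin_pow_nat_small b c (n : nat) p q : (n%:Z < q) -> lin_pow b c n p q = 0.
Proof.
case: q => [k|//] nk; rewrite /lin_pow; case: ifP => // _.
by rewrite binz_small ?mulr0z //; lia.
Qed.

Lemma odd2_mul_even b d c e :
  Odd2 b 0 0 d * Odd2 c 0 0 e = Odd2 (b * c) 0 0 (b * e + d * c) :> T.
Proof.
rewrite -[LHS]/(odd2_mul _ _) odd2_mulE /= rmorph0.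
by rewrite !(mulr0, mul0r, addr0, subr0).
Qed.

Lemma odd2_eq (M : Type) (a b c d a' b' c' d' : M) :
  a = a' -> b = b' -> c = c' -> d = d' -> Odd2 a b c d = Odd2 a' b' c' d'.
Proof. by do 4!move=> ->. Qed.

Lemma odd2_addE (M : zmodType) (s t : odd2 M) : s + t =
  Odd2 (oc s + oc t) (oc1 s + oc1 t) (oc2 s + oc2 t) (oc12 s + oc12 t).
Proof. by []. Qed.

Lemma superlin_powS b c d n p q : b \is a GRing.unit ->
  GRing.comm b c -> GRing.comm b d -> GRing.comm c d ->
  superlin_pow b c d (n + 1) p q =
  oconst b * superlin_pow b c d n (p - 1) q
  + oconst c * superlin_pow b c d n p (q - 1)
  + Odd2 0 0 0 d * superlin_pow b c d n p q.
Proof.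
move=> bU bc bd cd; have H := lin_powS _ _ _ bU bc.
have {}H1 := H n p q; have := H (n - 1) p q; rewrite subrK => H2.
rewrite /superlin_pow /oconst !odd2_mul_even !odd2_addE /=.
rewrite addrK {}H1; move: H2.
move: (lin_pow b c n p q) (lin_pow b c n (p - 1) q) (lin_pow b c n p (q - 1))
  (lin_pow b c (n - 1) _ _) (lin_pow b c (n - 1) _ _) => z x1 y1 x2 y2 ->.
have {}bd v : b * (d * v) = d * (b * v) by rewrite !mulrA bd.
have {}cd v : c * (d * v) = d * (c * v) by rewrite !mulrA cd.
apply: odd2_eq.
- by rewrite mul0r addr0.
- by rewrite !addr0.
- by rewrite !addr0.
have clean (A B C X Y Z : Lam) :
    A + 0 * X + (B + 0 * Y) + (0 * Z + C) = A + B + C.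
  by rewrite !mul0r !addr0 add0r.
rewrite clean mulrzDr mulr1z; congr (_ + _).
by rewrite mulrDr mulrzDl -bd -cd -!mulrzAr.
Qed.

Lemma superlin_pow0 b c d p q :
  superlin_pow b c d 0 p q = ((p, q) == (0, 0))%:R.
Proof. by rewrite /superlin_pow lin_pow0 mulr0z; case: eqP. Qed.

Lemma superlin_pow_small b c d n p q : (n < p) || (q < 0) ->
  superlin_pow b c d n p q = 0.
Proof.
move=> h; rewrite /superlin_pow !lin_pow_small ?mulr0 ?mul0rz //.
by move: h; lia.
Qed.

Lemma superlin_pow_nat_small b c d (n : nat) p q : (n%:Z < q) ->
  superlin_pow b c d n p q = 0.
Proof.
move=> h; rewrite /superlin_pow lin_pow_nat_small //.
case: n h => [|n] h; first by rewrite mulr0z.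
rewrite (_ : n.+1%:Z - 1 = n) ?lin_pow_nat_small ?mulr0 ?mul0rz //; lia.
Qed.

(** The forms b y + c z are homogeneous of degree 1; the phi1 phi2 coefficient
    has one degree less. *)
Lemma superlin_pow_low b c d n p q : (p + q < n - 1)%R ->
  superlin_pow b c d n p q = 0.
Proof.
move=> h; rewrite /superlin_pow.
have lp m : (p + q < m)%R -> lin_pow b c m p q = 0.
  by move=> hm; rewrite /lin_pow; case: q hm {h} => // k hm; case: ifP => // /eqP; lia.
by rewrite !lp ?mulr0 ?mul0rz //; lia.
Qed.

(** If c is nilpotent the expansion in nonnegative powers of z stops, so it
    also has bounded exponents in the other direction. *)
Lemma superlin_pow_nilp b c d (k : nat) n p q : c ^+ k = 0 -> (k%:Z <= q) ->
  superlin_pow b c d n p q = 0.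
Proof.
move=> ck h; rewrite /superlin_pow.
have lp m : lin_pow b c m p q = 0.
  rewrite /lin_pow; case: q h => // j hm; case: ifP => // _.
  have kj : (k <= j)%N by lia.
  by rewrite -(subnK kj) exprD ck !mulr0 mul0rz.
by rewrite !lp ?mulr0 ?mul0rz.
Qed.

End SuperPowers.

(** * Sums with finite support *)

Section FiniteSums.
Local Open Scope classical_set_scope.
Variable I : choiceType.

Definition finsupp_fam (M : zmodType) (G : I -> M) : Prop :=
  exists A : {fset I}, forall x, x \notin A -> G x = 0.

(** A sum over infinite support has the default value 0, so that additivity
    needs the finiteness of all three supports. *)
Lemma fsum_addl3 (R : pzRingType) (a b c : R) (f g h : I -> R) :
  finsupp_fam f -> finsupp_fam g -> finsupp_fam h ->
  a * (\sum_(x \in [set: I]) f x) + b * (\sum_(x \in [set: I]) g x)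
    + c * (\sum_(x \in [set: I]) h x)
  = \sum_(x \in [set: I]) (a * f x + b * g x + c * h x).
Proof.
move=> [A fA] [B gB] [C hC]; pose D := (A `|` B `|` C)%fset.
have DP x : x \notin D -> [/\ f x = 0, g x = 0 & h x = 0].
  by rewrite !inE !negb_or => /andP[/andP[/fA-> /gB->] /hC->].
rewrite !(@fsbigTE _ _ _ _ D) => [|x /DP[-> -> ->]|x /DP[]|x /DP[]|x /DP[]] //.
  by rewrite !mulr_sumr -!big_split.
by rewrite !mulr0 !addr0.
Qed.

Lemma fsum_single (M : zmodType) (a : I) (G : I -> M) :
  (forall b, b != a -> G b = 0) -> \sum_(b \in [set: I]) G b = G a.
Proof.
move=> h; rewrite (@fsbigTE _ _ _ _ [fset a]%fset) ?big_seq_fset1 //.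
by move=> b; rewrite inE => /h.
Qed.

Lemma fsum_morph (M N : zmodType) (f : M -> N) (G : I -> M) :
  f 0 = 0 -> {morph f : x y / x + y} -> finsupp_fam G ->
  f (\sum_(a \in [set: I]) G a) = \sum_(a \in [set: I]) f (G a).
Proof.
move=> f0 fD [A GA]; rewrite !(@fsbigTE _ _ _ _ A) //; last first.
  by move=> a /GA ->.
exact: big_morph.
Qed.

End FiniteSums.

Lemma fsum_support (I J : choiceType) (M : zmodType) (h : I -> J) (G : J -> M) :
  injective h -> (forall y, (forall x, y <> h x) -> G y = 0) ->
  \sum_(y \in [set: J]) G y = \sum_(x \in [set: I]) G (h x).
Proof.
move=> hI h0; rewrite -(@fsbig_image _ _ _ _ _ [set: I] h G); last first.
  by move=> x y _ _; exact: hI.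
apply/esym/fsbig_widen => // y [_ /= nh]; apply: h0 => x e.
by apply: nh; exists x.
Qed.

Lemma fsum_shift (I : zmodType) (M : zmodType) (f : I -> M) (d : I) :
  \sum_(x \in [set: I]) f x = \sum_(x \in [set: I]) f (x - d).
Proof.
rewrite (@reindex_fsbigT _ _ _ _ _ (fun x => x - d)) //.
by exists (fun x => x + d) => x; rewrite ?subrK ?addrK.
Qed.

Lemma finsupp_box (M : zmodType) (G : int * int -> M) (a b c d : int) :
  (forall e, G e != 0 -> [&& a <= e.1, e.1 <= b, c <= e.2 & e.2 <= d]) ->
  finsupp_fam G.
Proof.
move=> GP.
pose r : seq (int * int) := [seq (a + x%:Z, c + y%:Z) |
  x <- iota 0 (absz (b - a)).+1, y <- iota 0 (absz (d - c)).+1].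
exists [fset x in r]%fset => -[p q]; rewrite in_fset => er.
apply: contraNeq er => /GP/and4P[/= h1 h2 h3 h4].
apply/allpairsP; exists (absz (p - a), absz (q - c)).
by rewrite !mem_iota /=; split; [lia|lia|congr pair; lia].
Qed.

(** Everything below comes in two versions, exchanged by swapping x1 and x2.
    A boolean selects the version: false for expansions in nonnegative powers
    of x2, true for those in nonnegative powers of x1. *)
Definition flip (sw : bool) (e : int * int) : int * int :=
  if sw then (e.2, e.1) else e.

(** * Conical series

    The coefficients are in an arbitrary ring, of which C[phi1, phi2] with
    Grassmann coefficients is an instance. *)

Section Series.
Variable R : nzRingType.
Implicit Types (S X : int * int -> R) (sw : bool) (e d : int * int).

Definition conv X S : int * int -> R := fun e =>
  \sum_(a \in [set: int * int]) X a * S (e - a).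

(** These are the supports for which convolutions are finite sums: two opposite
    quadrants, one translated with respect to the other, have a finite
    intersection. *)
Definition cone sw S : Prop := exists N : nat, forall e,
  S e != 0 -> ((flip sw e).1 <= N%:Z) && (- N%:Z <= (flip sw e).2).

Lemma cone_shift sw S d : cone sw S -> cone sw (fun e => S (e - d)).
Proof.
move=> [N SN]; exists (N + `|d.1| + `|d.2|)%N => e /SN.
by case: sw {SN}; rewrite /=; lia.
Qed.

Lemma conv_finsupp sw X S e : cone sw X -> cone sw S ->
  finsupp_fam (fun a => X a * S (e - a)).
Proof.
move=> [N XN] [M SM].
have h a : X a * S (e - a) != 0 ->
    [&& (flip sw e).1 - M%:Z <= (flip sw a).1, (flip sw a).1 <= N,
        - N%:Z <= (flip sw a).2 & (flip sw a).2 <= (flip sw e).2 + M%:Z].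
  move=> nz; have /XN : X a != 0 by apply: contraNneq nz => ->; rewrite mul0r.
  have /SM : S (e - a) != 0 by apply: contraNneq nz => ->; rewrite mulr0.
  by clear; case: sw; rewrite /=; lia.
by case: sw {XN SM} h => h; apply: finsupp_box => a /h; rewrite /flip /= => H;
  apply/and4P; move/and4P: H => [h1 h2 h3 h4]; split; eassumption.
Qed.

Lemma cone_conv sw X S : cone sw X -> cone sw S -> cone sw (conv X S).
Proof.
move=> [N XN] [M SM]; exists (N + M)%N => e nz.
have [a [Xa Sa]] : exists a, X a != 0 /\ S (e - a) != 0.
  apply: contrapT => no; case/eqP: nz; apply: fsbig1 => a _.
  have [->|Xa] := eqVneq (X a) 0; first by rewrite mul0r.
  have [->|Sa] := eqVneq (S (e - a)) 0; first by rewrite mulr0.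
  by case: no; exists a.
move: (XN _ Xa) (SM _ Sa); clear.
by case: sw; rewrite /=; lia.
Qed.

(** Multiplication by the linear form c1 x1 + c2 x2 + c0. *)
Definition lin (c1 c2 c0 : R) S : int * int -> R := fun e =>
  c1 * S (e - (1, 0)) + c2 * S (e - (0, 1)) + c0 * S e.

Lemma cone_lin sw c1 c2 c0 S : cone sw S -> cone sw (lin c1 c2 c0 S).
Proof.
move=> [N SN]; exists N.+1 => e; apply: contraNT => h.
have S0 e' : ~~ (((flip sw e').1 <= N%:Z) && (- N%:Z <= (flip sw e').2)) -> S e' = 0.
  by move=> h'; apply: contraNeq h' => /SN.
rewrite /lin !S0 ?mulr0 ?addr0 //; move: h; clear;
by case: sw; rewrite /=; lia.
Qed.

(** This replaces the associativity of convolution: the left factor is always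
    a linear form, and then only finitely many shifts are involved. *)
Lemma lin_convl sw c1 c2 c0 X S : cone sw X -> cone sw S ->
  lin c1 c2 c0 (conv X S) = conv (lin c1 c2 c0 X) S.
Proof.
move=> cX cS; apply/funext => e; rewrite /lin /conv.
have re d : \sum_(a \in [set: int * int]) X a * S (e - d - a) =
            \sum_(a \in [set: int * int]) X (a - d) * S (e - a).
  rewrite (fsum_shift _ d); apply: eq_fsbigr => b _.
  by congr (_ * S _); rewrite opprB addrA subrK.
move: (1, 0) (0, 1) => d1 d2; rewrite (re d1) (re d2) fsum_addl3.
- by apply: eq_fsbigr => a _; rewrite !mulrDl !mulrA.
- apply: conv_finsupp cS; exact: cone_shift.
- apply: conv_finsupp cS; exact: cone_shift.
exact: conv_finsupp cS.
Qed.

Lemma lin_convr sw c1 c2 c0 X S :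
  (forall b, c1 * b = b * c1) -> (forall b, c2 * b = b * c2) ->
  (forall b, c0 * b = b * c0) -> cone sw X -> cone sw S ->
  lin c1 c2 c0 (conv X S) = conv X (lin c1 c2 c0 S).
Proof.
move=> C1 C2 C12 cX cS; apply/funext => e; rewrite /lin /conv.
move: (1, 0) (0, 1) => d1 d2.
rewrite fsum_addl3; first last.
- exact: conv_finsupp cS.
- exact: conv_finsupp cX cS.
- exact: conv_finsupp cX cS.
apply: eq_fsbigr => a _; rewrite !mulrDr.
have subAC d : e - a - d = e - d - a by rewrite addrAC.
by rewrite (subAC d1) (subAC d2) !mulrA -C1 -C2 -C12.
Qed.

Lemma linC (c1 c2 c0 d1 d2 d0 : R) S :
  (forall b, c1 * b = b * c1) -> (forall b, c2 * b = b * c2) ->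
  (forall b, c0 * b = b * c0) ->
  lin c1 c2 c0 (lin d1 d2 d0 S) = lin d1 d2 d0 (lin c1 c2 c0 S).
Proof.
move=> C1 C2 C0; apply/funext => e; rewrite /lin.
move: (1, 0) (0, 1) => u1 u2.
have subAC : e - u2 - u1 = e - u1 - u2 by rewrite addrAC.
rewrite !mulrDr !mulrA !(C1 d1, C1 d2, C1 d0, C2 d1, C2 d2, C2 d0, C0 d1, C0 d2, C0 d0).
by rewrite subAC !addrA [LHS](ACl (1*4*7*2*5*8*3*6*9)).
Qed.

Definition ser_one : int * int -> R := fun e => (e == (0, 0))%:R.

Lemma conv1 S : conv ser_one S = S.
Proof.
apply/funext => e; rewrite /conv (@fsbigTE _ _ _ _ [fset (0, 0)]%fset).
  by rewrite big_seq_fset1 /ser_one eqxx mul1r subr0.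
by move=> a; rewrite inE /ser_one => /negPf ->; rewrite mul0r.
Qed.

(** The formula of [ser_of_poly], over any ring. *)
Definition polyser (g : {poly {poly R}}) : int * int -> R := fun e =>
  if e is (Posz p, Posz q) then g`_q`_p else 0.

Lemma polyser_lin c1 c2 c0 g :
  polyser ((c1%:P%:P * 'X%:P + c2%:P%:P * 'X + c0%:P%:P) * g) =
  lin c1 c2 c0 (polyser g).
Proof.
have cf q p : ((c1%:P%:P * 'X%:P + c2%:P%:P * 'X + c0%:P%:P) * g)`_q`_p =
    c1 * (if p is p'.+1 then g`_q`_p' else 0) +
    c2 * (if q is q'.+1 then g`_q'`_p else 0) + c0 * g`_q`_p.
  rewrite !mulrDl !coefD -!mulrA !coefCM -!commr_polyX !coefMX.
  by congr (_ + _ + _); congr (_ * _); [case: p|case: q => //; rewrite coef0].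
have eN n : Negz n - 1 = Negz n.+1 by lia.
apply/funext => -[[p|p] [q|q]]; rewrite /lin.
- rewrite {1}/polyser cf.
  have -> : (Posz p, Posz q) - (0, 1) = (Posz p, Posz q - 1).
    by congr pair; exact: subr0.
  have -> : (Posz p, Posz q) - (1, 0) = (Posz p - 1, Posz q).
    by congr pair; exact: subr0.
  have e0 : 0%:Z - 1 = Negz 0 by [].
  have eS n : n.+1%:Z - 1 = n by lia.
  congr (_ * _ + _ * _ + _ * _).
    by case: p => [|p]; rewrite ?e0 ?eS.
  by case: q => [|q]; rewrite ?e0 ?eS.
- have -> : (Posz p, Negz q) - (0, 1) = (Posz p, Negz q.+1).
    by congr pair; [exact: subr0|exact: eN].
  have -> : (Posz p, Negz q) - (1, 0) = (Posz p - 1, Negz q).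
    by congr pair; exact: subr0.
  by rewrite /= !mulr0 !addr0; case: (_ - _) => a; rewrite /= mulr0.
- have -> : (Negz p, Posz q) - (0, 1) = (Negz p, Posz q - 1).
    by congr pair; exact: subr0.
  have -> : (Negz p, Posz q) - (1, 0) = (Negz p.+1, Posz q).
    by congr pair; [exact: eN|exact: subr0].
  by rewrite /= !mulr0 !addr0.
have -> : (Negz p, Negz q) - (0, 1) = (Negz p, Negz q.+1).
  by congr pair; [exact: subr0|exact: eN].
have -> : (Negz p, Negz q) - (1, 0) = (Negz p.+1, Negz q).
  by congr pair; [exact: eN|exact: subr0].
by rewrite /= !mulr0 !addr0.
Qed.

Lemma cone_polyser sw g : cone sw (polyser g).
Proof.
exists (size g + \max_(k < size g) size (g`_k)%R)%N => -[[p|p] [q|q]] //=; rewrite ?eqxx // => nz.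
have qg : (q < size g)%N.
  by rewrite ltnNge; apply: contraNN nz => h; rewrite (nth_default _ h) coef0.
have pg : (p < size (g`_q)%R)%N.
  by rewrite ltnNge; apply: contraNN nz => h; rewrite (nth_default _ h).
have := leq_trans pg (@leq_bigmax _ (fun k : 'I_(size g) => size (g`_k)%R) (Ordinal qg)).
by move: qg; clear; case: sw; rewrite /=; lia.
Qed.

Lemma polyser_eq0 g : polyser g = (fun=> 0) -> g = 0.
Proof.
move=> e; apply/polyP => q; apply/polyP => p; rewrite !coef0.
exact: (congr1 (fun s => s (Posz p, Posz q)) e).
Qed.

End Series.

(** * The expansion maps *)

Section Expansions.
Local Open Scope quotient_scope.
Variables (F : fieldType) (L : option nat).
Local Notation Lam := (grassmann F L).
Local Notation T := (odd2 Lam).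
Implicit Types (S X : int * int -> T) (t : linform F L) (sw : bool) (e : int * int).

(** Multiplication of series by an element of S'. *)
Definition lin_act t S : int * int -> T :=
  let: (a1, a2, a12) := val t in
  lin (oconst a1) (oconst a2) (Odd2 0 0 0 a12) S.

Arguments lin_act : simpl never.

Lemma linform_central_coef t : let: (a1, a2, a12) := val t in
  [/\ forall b : T, oconst a1 * b = b * oconst a1,
      forall b : T, oconst a2 * b = b * oconst a2 &
      forall b : T, Odd2 0 0 0 a12 * b = b * Odd2 0 0 0 a12].
Proof.
case: t => [[[a1 a2] a12] /= /and4P[ev1 ev2 ev12 _]].
have ev0 := gr_homog0 F L false.
by split=> b; apply: odd2_even_central.
Qed.

Implicit Types (g : superpoly F L) (l : seq (linform F L)).

(** The power (b y + c z + d phi1 phi2) ^ n as a series in x1 and x2, where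
    y is x1 or x2, and z, in which the expansion is nonnegative, is the other
    variable. *)
Definition spow sw (b c d : Lam) n : ser2 F L := fun e =>
  superlin_pow b c d n (flip sw e).1 (flip sw e).2.

Lemma cone_spow sw b c d n : cone sw (spow sw b c d n).
Proof.
exists `|n|%N => e; apply: contraNT => h; apply/eqP/superlin_pow_small.
by move: h; lia.
Qed.

(** Nilpotency of the coefficient of z is what allows the expansion in the
    wrong variable, used when the coefficient of the leading variable has body
    zero. *)
Lemma cone_spow_nilp sw b c d n k : c ^+ k = 0 -> cone (~~ sw) (spow sw b c d n).
Proof.
move=> ck; exists (`|n| + k + 1)%N => e; apply: contraNT => h; apply/eqP.
have [h1|h1] := leP k%:Z (flip sw e).2; first exact: superlin_pow_nilp ck h1.
have [h2|h2] := ltP (flip sw e).2 0.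
  by apply: superlin_pow_small; rewrite h2 orbT.
apply: superlin_pow_low; move: h h1 h2; clear.
by case: sw; rewrite /=; lia.
Qed.

Lemma lin_act_spow sw t n :
  let: (a1, a2, a12) := val t in
  gr_body (if sw then a2 else a1) != 0 ->
  lin_act t (spow sw (if sw then a2 else a1) (if sw then a1 else a2) a12 n)
  = spow sw (if sw then a2 else a1) (if sw then a1 else a2) a12 (n + 1).
Proof.
rewrite /lin_act /lin /spow.
case: t => [[[a1 a2] a12] /= /and4P[ev1 ev2 ev12 _]] bn.
have bU := gr_body_unit bn.
have c12 : GRing.comm a1 a2 by exact: gr_evenC.
have c13 : GRing.comm a1 a12 by exact: gr_evenC.
have c23 : GRing.comm a2 a12 by exact: gr_evenC.
apply/funext => -[p q].
have -> : (p, q) - (0, 1) = (p, q - 1) by congr pair; exact: subr0.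
have -> : (p, q) - (1, 0) = (p - 1, q) by congr pair; exact: subr0.
case: sw bn bU => bn bU; last exact: (esym (superlin_powS n p q bU c12 c13 c23)).
apply: esym; apply: (eq_trans (superlin_powS n q p bU (commr_sym c12) c23 c13)).
have swapD (x y z : T) : x + y + z = y + x + z by rewrite [x + y]addrC.
exact: swapD.
Qed.

(** The two prescribed expansions of the inverses of the elements of S'. *)
Definition expand_inv sw t : ser2 F L :=
  if sw then iota21_inv_lin t else iota12_inv_lin t.

(** Both expansions are powers with exponent -1 whose leading coefficient is
    invertible; the variable y is not the one that the version asks for only if
    the other coefficient has body zero. *)
Lemma expand_invE sw t : exists sw',
  let: (a1, a2, a12) := val t in
  [/\ gr_body (if sw' then a2 else a1) != 0,
      expand_inv sw t =
        spow sw' (if sw' then a2 else a1) (if sw' then a1 else a2) a12 (-1)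
    & (sw' != sw) -> gr_body (if sw' then a1 else a2) = 0].
Proof.
rewrite /expand_inv /iota12_inv_lin /iota21_inv_lin /spow.
case: t => [[[a1 a2] a12] /= /and4P[_ _ _ b12]].
case: sw; [have [b2|b2] := eqVneq (gr_body a2) 0|have [b1|b1] := eqVneq (gr_body a1) 0].
- by exists false; split => //; move: b12; rewrite b2 eqxx orbF.
- by exists true.
- by exists true; split => //; move: b12; rewrite b1 eqxx.
by exists false.
Qed.

Lemma cone_expand_inv sw t : cone sw (expand_inv sw t).
Proof.
have [sw'] := expand_invE sw t; case: (val t) => [[a1 a2] a12] [_ -> h].
have [->|ne] := eqVneq sw' sw; first exact: cone_spow.
have [k ck] := gr_body0_nilpotent (h ne).
by rewrite (_ : sw = ~~ sw'); [exact: cone_spow_nilp ck | case: sw sw' {h ck} ne => -[]].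
Qed.

Lemma lin_act_expand_inv sw t : lin_act t (expand_inv sw t) = @ser_one T.
Proof.
have [sw'] := expand_invE sw t; have := @lin_act_spow sw' t (-1).
case: (val t) => [[a1 a2] a12] h [b -> _]; rewrite h // addNr.
apply/funext => -[p q]; rewrite /spow superlin_pow0 /ser_one.
by case: sw' {h b}; rewrite //= !xpair_eqE andbC.
Qed.

Lemma cone_lin_act sw t S : cone sw S -> cone sw (lin_act t S).
Proof. by rewrite /lin_act; case: (val t) => [[a1 a2] a12]; exact: cone_lin. Qed.

Lemma lin_act_expand_mul sw t S : cone sw S ->
  lin_act t (conv (expand_inv sw t) S) = S.
Proof.
move=> cS; have := lin_act_expand_inv sw t; rewrite /lin_act.
case: (val t) => [[a1 a2] a12] e.
by rewrite (lin_convl _ _ _ (cone_expand_inv sw t) cS) e conv1.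
Qed.

Lemma expand_mul_lin_act sw t S : cone sw S ->
  conv (expand_inv sw t) (lin_act t S) = S.
Proof.
move=> cS; have := lin_act_expand_mul t cS; have := linform_central_coef t.
rewrite /lin_act; case: (val t) => [[a1 a2] a12] [C1 C2 C0].
by rewrite (lin_convr C1 C2 C0 (cone_expand_inv sw t) cS).
Qed.

Definition lin_acts l S : int * int -> T := foldr lin_act S l.

Lemma lin_acts_cons t l S : lin_acts (t :: l) S = lin_act t (lin_acts l S).
Proof. by []. Qed.

Lemma lin_acts_cat l m S : lin_acts (l ++ m) S = lin_acts l (lin_acts m S).
Proof. exact: foldr_cat. Qed.

Lemma cone_lin_acts sw l S : cone sw S -> cone sw (lin_acts l S).
Proof. by move=> cS; elim: l => [|t l IH]; [exact: cS|exact: cone_lin_act]. Qed.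

(** The elements of S' act invertibly on conical series; the inverse is the
    convolution with the expansion. *)
Lemma lin_acts_inj sw l S X : cone sw S -> cone sw X ->
  lin_acts l S = lin_acts l X -> S = X.
Proof.
move=> cS cX; elim: l => [//|t l IH] /= e; apply: IH.
rewrite -(expand_mul_lin_act t (cone_lin_acts l cS)) e.
exact/expand_mul_lin_act/cone_lin_acts.
Qed.

Lemma ser_of_poly_lin t g :
  ser_of_poly (linform_val t * g) = lin_act t (ser_of_poly g).
Proof.
rewrite /lin_act /linform_val; case: (val t) => [[a1 a2] a12].
rewrite oconst_phi12; exact: polyser_lin.
Qed.

Lemma ser_of_poly_den l g :
  ser_of_poly (den (S := linform_denoms F L) l * g) = lin_acts l (ser_of_poly g).
Proof.
elim: l => [|t l IH]; first by rewrite /den big_nil mul1r.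
by rewrite /den big_cons -mulrA ser_of_poly_lin IH.
Qed.

Lemma ser_of_poly_inj g h : ser_of_poly g = ser_of_poly h -> g = h.
Proof.
move=> e; apply/eqP; rewrite -subr_eq0; apply/eqP/polyser_eq0/funext => a.
have := congr1 (fun s => s a) e; rewrite /ser_of_poly /polyser.
by case: a => [[p|p] [q|q]] //; rewrite !coefB => ->; rewrite subrr.
Qed.

Definition expand sw (f : superfun F L) : int * int -> T :=
  if sw then iota21 f else iota12 f.

(** The expansion is computed from a chosen representative of f, so that its
    value on other fractions equal to f is not immediate. *)
Lemma expand_fold sw f : expand sw f =
  foldr (fun t s => conv (expand_inv sw t) s) (ser_of_poly (repr f).1) (repr f).2.
Proof. by case: sw; rewrite /expand /iota21 /iota12; case: (repr f). Qed.

Lemma lin_actC t t' S : lin_act t (lin_act t' S) = lin_act t' (lin_act t S).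
Proof.
move: (linform_central_coef t).
rewrite /lin_act; case: (val t) (val t') => [[a1 a2] a12] [[b1 b2] b12] [C1 C2 C0].
exact: linC.
Qed.

Lemma lin_acts_lin_act l t S : lin_acts l (lin_act t S) = lin_act t (lin_acts l S).
Proof.
elim: l => [|t' l IH]; first by reflexivity.
by rewrite !lin_acts_cons IH lin_actC.
Qed.

Lemma expand_fold_spec sw g l :
  let S := foldr (fun t s => conv (expand_inv sw t) s) (ser_of_poly g) l in
  cone sw S /\ lin_acts l S = ser_of_poly g.
Proof.
elim: l => [|t l [cS eS]] /=; first by split; [exact: cone_polyser|].
split; first exact/cone_conv/cS/cone_expand_inv.
by rewrite -lin_acts_lin_act lin_act_expand_mul.
Qed.

Lemma lin_acts_catC l m S : lin_acts l (lin_acts m S) = lin_acts m (lin_acts l S).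
Proof. by elim: l => [//|t l IH]; rewrite !lin_acts_cons IH lin_acts_lin_act. Qed.

Definition sfrac g l : superfun F L := \pi_(loc (linform_denoms F L)) (g, l).

(** The representing fraction g' / l' satisfies n l' g = n l g' for some
    product n of elements of S'.  As n and l' can be cancelled, the equation
    l' S = g' for the expansion S implies l S = g. *)
Lemma expand_sfrac sw g l :
  cone sw (expand sw (sfrac g l)) /\
  lin_acts l (expand sw (sfrac g l)) = ser_of_poly g.
Proof.
rewrite expand_fold /sfrac.
have [n] := loc_repr (S := linform_denoms F L) (g, l).
case: (repr _) => g' l' /= e.
have [cS eS] := expand_fold_spec sw g' l'; split=> //.
set S := foldr _ _ _ in cS eS *.
apply: (@lin_acts_inj sw (n ++ l')); [exact: cone_lin_acts|exact: cone_polyser|].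
rewrite -ser_of_poly_den e ser_of_poly_den !lin_acts_cat -eS.
by congr (lin_acts n _); exact: lin_acts_catC.
Qed.

Lemma frac_surj f : exists g l, f = sfrac g l.
Proof. by exists (repr f).1, (repr f).2; rewrite /sfrac -surjective_pairing reprK. Qed.

(** Together with [expand_sfrac] this characterizes the expansion by an
    equation between conical series. *)
Lemma expandP sw g l S : cone sw S -> lin_acts l S = ser_of_poly g ->
  expand sw (sfrac g l) = S.
Proof.
have [c e] := expand_sfrac sw g l => cS eS.
by apply: (lin_acts_inj (l := l) c cS); rewrite e eS.
Qed.

Lemma expand_inj sw : injective (expand sw).
Proof.
move=> f h; have [g [l ->]] := frac_surj f; have [g' [l' ->]] := frac_surj h.
have [_ e] := expand_sfrac sw g l; have [_ e'] := expand_sfrac sw g' l' => E.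
apply/loc_eqP/asboolP; exists [::] => /=.
apply: ser_of_poly_inj; rewrite !ser_of_poly_den -e -e' E.
exact: lin_acts_catC.
Qed.

Lemma fracN g l : - sfrac g l = sfrac (- g) l.
Proof. by rewrite -[LHS]/(loc_opp _) /sfrac !piE. Qed.

Lemma expandN sw f : expand sw (- f) = fun e => - expand sw f e.
Proof.
have [g [l ->]] := frac_surj f; have [c e] := expand_sfrac sw g l.
rewrite fracN; apply: expandP.
  by case: c => N cN; exists N => a; rewrite oppr_eq0; exact: cN.
have lN S : lin_acts l (fun a => - S a) = fun a => - lin_acts l S a.
  elim: l {e c} => [//|t l IH]; rewrite !lin_acts_cons IH; apply/funext => a.
  rewrite /lin_act /lin; case: (val t) => [[a1 a2] a12].
  by rewrite !mulrN -!opprD.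
rewrite lN e; apply/funext => -[[p|p] [q|q]] /=; rewrite ?oppr0 //.
by rewrite !coefN.
Qed.

Lemma expandZsign sw f (b : bool) :
  expand sw (f *~ (-1) ^+ b) = fun e => expand sw f e *~ (-1) ^+ b.
Proof.
case: b; rewrite ?expr0 ?expr1 ?mulrN1z ?mulr1z; last by apply/funext.
by rewrite expandN; apply/funext => e; rewrite mulrN1z.
Qed.

End Expansions.

(** * Fractions with denominators in x1, x2 and x1 - x2 - phi1 phi2 *)

Section LinearPolynomials.
Variable R : nzRingType.

Lemma linpoly_x1 :
  (1 : R)%:P%:P * 'X%:P + 0%:P%:P * 'X + 0%:P%:P = 'X%:P :> {poly {poly R}}.
Proof. by rewrite !polyC0 !polyC1 !mul0r mul1r !addr0. Qed.

Lemma linpoly_x2 :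
  (0 : R)%:P%:P * 'X%:P + 1%:P%:P * 'X + 0%:P%:P = 'X :> {poly {poly R}}.
Proof. by rewrite !polyC0 !polyC1 !mul0r mul1r add0r addr0. Qed.

Lemma linpoly_d12 (c : R) :
  1%:P%:P * 'X%:P + (-1)%:P%:P * 'X + (- c)%:P%:P
  = 'X%:P - 'X - c%:P%:P :> {poly {poly R}}.
Proof. by rewrite !polyCN !polyC1 mulN1r mul1r. Qed.

End LinearPolynomials.

Section LocalizationFractions.
Local Open Scope quotient_scope.

Lemma loc_frac_div (P : nzRingType) (S : denoms P) (p : P) (l : seq S) :
  \pi_(loc S) (p, l) = loc_of S p / loc_of S (den l).
Proof.
have e1 : loc_of S (den l) * \pi_(loc S) (1, l) = 1.
  rewrite -[LHS]/(loc_mul _ _) /loc_of !piE.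
  apply/loc_eqP/asboolP; exists [::].
  by rewrite /= mulr1 den_nil.
have e2 : \pi_(loc S) (1, l) * loc_of S (den l) = 1.
  rewrite -[LHS]/(loc_mul _ _) /loc_of !piE.
  apply/loc_eqP/asboolP; exists [::].
  by rewrite /= cats0 mul1r den_nil mulr1.
have u : loc_of S (den l) \is a GRing.unit by apply/unitrP; exists (\pi_(loc S) (1, l)).
rewrite (_ : (loc_of S (den l))^-1 = \pi_(loc S) (1, l)); last first.
  by rewrite -[LHS]mul1r -e2 mulrK.
rewrite -[RHS]/(loc_mul _ _) /loc_of !piE.
by rewrite /loc_mulf /= mulr1.
Qed.

End LocalizationFractions.

Section Fractions.
Variables (F : fieldType) (L : option nat).
Local Notation Lam := (grassmann F L).
Local Notation T := (odd2 Lam).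
Implicit Types (S X : int * int -> T) (t : linform F L) (sw : bool) (e : int * int).
Implicit Types (g : superpoly F L) (l : seq (linform F L)).

Let gb1 : gr_body (1 : Lam) = 1. Proof. exact: rmorph1. Qed.

Fact lf_x1_proof : is_linform ((1, 0, 0) : Lam * Lam * Lam).
Proof. by rewrite /is_linform gr_homog1 !gr_homog0 gb1 oner_eq0. Qed.
Fact lf_x2_proof : is_linform ((0, 1, 0) : Lam * Lam * Lam).
Proof. by rewrite /is_linform gr_homog1 !gr_homog0 gb1 oner_eq0 orbT. Qed.
Fact lf_d12_proof : is_linform ((1, -1, -1) : Lam * Lam * Lam).
Proof. by rewrite /is_linform (gr_homogN (gr_homog1 _ _)) gr_homog1 gb1 oner_eq0. Qed.
Fact lf_d21_proof : is_linform ((-1, 1, 1) : Lam * Lam * Lam).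
Proof. by rewrite /is_linform (gr_homogN (gr_homog1 _ _)) gr_homog1 gb1 oner_eq0 orbT. Qed.

(** The elements x1, x2, x1 - x2 - phi1 phi2 and x2 - x1 + phi1 phi2 of S'. *)
Definition lf_x1 : linform F L := Sub _ lf_x1_proof.
Definition lf_x2 : linform F L := Sub _ lf_x2_proof.
Definition lf_d12 : linform F L := Sub _ lf_d12_proof.
Definition lf_d21 : linform F L := Sub _ lf_d21_proof.

Let oconst0 : oconst (0 : Lam) = 0. Proof. by []. Qed.
Let oconst1 : oconst (1 : Lam) = 1. Proof. by []. Qed.
Let oconstN (a : Lam) : oconst (- a) = - oconst a.
Proof. by rewrite /oconst -[RHS]/(Odd2 _ _ _ _) !oppr0. Qed.

Lemma phi12E : phi1 * phi2 = Odd2 0 0 0 1 :> T.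
Proof. by rewrite -oconst_phi12 oconst1 mul1r. Qed.

Lemma odd12N (a : Lam) : Odd2 0 0 0 (- a) = - Odd2 0 0 0 a.
Proof. by rewrite -[RHS]/(Odd2 _ _ _ _) !oppr0. Qed.

Lemma linform_val_x1 : linform_val lf_x1 = sp_x1.
Proof. by rewrite /linform_val /= oconst_phi12; exact: linpoly_x1. Qed.

Lemma linform_val_x2 : linform_val lf_x2 = sp_x2.
Proof. by rewrite /linform_val /= oconst_phi12; exact: linpoly_x2. Qed.

Lemma linform_val_d12 : linform_val lf_d12 = sp_x1 - sp_x2 - sp_const (phi1 * phi2).
Proof.
rewrite /linform_val /= oconst_phi12 phi12E oconstN odd12N; exact: linpoly_d12.
Qed.

Lemma lin_act_x1 S e : lin_act lf_x1 S e = S (e - (1, 0)).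
Proof.
rewrite /lin_act /lin /= oconst0 oconst1 mul1r.
have clean (x y z : T) : x + 0 * y + 0 * z = x by rewrite !mul0r !addr0.
exact: clean.
Qed.

Lemma lin_act_x2 S e : lin_act lf_x2 S e = S (e - (0, 1)).
Proof.
rewrite /lin_act /lin /= oconst0 oconst1.
have clean (x y z : T) : 0 * x + 1 * y + 0 * z = y.
  by rewrite !mul0r mul1r add0r addr0.
exact: clean.
Qed.

Lemma lin_act_d21 S e : lin_act lf_d21 S e = - lin_act lf_d12 S e.
Proof.
rewrite /lin_act /lin /= oconstN oconst1.
rewrite odd12N.
have clean (x y z u : T) : -1 * x + 1 * y + u * z = - (1 * x + -1 * y + - u * z).
  by rewrite !mulN1r !mul1r mulNr !opprD !opprK.
exact: clean.
Qed.

Lemma lin_acts_nseq_x1 n S e : lin_acts (nseq n lf_x1) S e = S (e - (n%:Z, 0)).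
Proof.
elim: n e => [|n IH] e; first by rewrite subr0.
rewrite [nseq _ _]/= lin_acts_cons lin_act_x1 IH.
congr S; rewrite -addrA -opprD; congr (_ - _).
Qed.

Lemma lin_acts_nseq_x2 n S e : lin_acts (nseq n lf_x2) S e = S (e - (0, n%:Z)).
Proof.
elim: n e => [|n IH] e; first by rewrite subr0.
rewrite [nseq _ _]/= lin_acts_cons lin_act_x2 IH.
congr S; rewrite -addrA -opprD; congr (_ - _).
Qed.

Lemma lin_acts_nseq_d21 n S e :
  lin_acts (nseq n lf_d21) S e = lin_acts (nseq n lf_d12) S e *~ (-1) ^+ n.
Proof.
elim: n e => [|n IH] e; first by [].
rewrite [nseq _ _]/= lin_acts_cons [nseq _ lf_d12]/= lin_acts_cons lin_act_d21.
rewrite (_ : lin_acts _ _ = fun e => lin_acts (nseq n lf_d12) S e *~ (-1) ^+ n).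
  rewrite exprS mulN1r mulrNz; congr (- _); rewrite /lin_act /lin.
  case: (val lf_d12) => [[a1 a2] a12].
  by rewrite !mulrzAr -!mulrzDl.
exact/funext.
Qed.

(** Nonnegative powers occur in the Jacobi identity as the expansions of the
    delta functions; on conical series they act as iterated linear forms. *)
Lemma conv_spow sw t (n : nat) S :
  let: (a1, a2, a12) := val t in
  gr_body (if sw then a2 else a1) != 0 -> cone sw S ->
  conv (spow sw (if sw then a2 else a1) (if sw then a1 else a2) a12 n) S =
  lin_acts (nseq n t) S.
Proof.
have := @lin_act_spow F L sw t; have lc := @lin_convl T sw.
have : forall X, lin_act t X = let: (a1, a2, a12) := val t in
    lin (oconst a1) (oconst a2) (Odd2 0 0 0 a12) X by [].
case: (val t) => [[a1 a2] a12] lE H b cS.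
elim: n => [|n IH].
  rewrite -[RHS]conv1; congr (conv _ S); apply/funext => e.
  rewrite /spow superlin_pow0 /ser_one.
  by case: sw {lc H b cS}; case: e => p q; rewrite /= !xpair_eqE // andbC.
have -> : n.+1%:Z = n%:Z + 1 by lia.
apply: (eq_trans (congr1 (fun Z => conv Z S) (esym (H n b)))).
rewrite lE.
apply: (eq_trans (esym (lc _ _ _ _ _ (cone_spow _ _ _ _ _) cS))).
by rewrite [nseq _ _]/= lin_acts_cons lE IH.
Qed.

Lemma sfrac_div g l :
  sfrac g l = sf_of g / sf_of (den (S := linform_denoms F L) l).
Proof. exact: loc_frac_div. Qed.

Lemma sfrac_std g (r s t : nat) :
  sfrac g (nseq r lf_x1 ++ nseq s lf_x2 ++ nseq t lf_d12) =
  sf_of g / (sf_of sp_x1 ^ r * sf_of sp_x2 ^ s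
             * sf_of (sp_x1 - sp_x2 - sp_const (phi1 * phi2)) ^ t).
Proof.
rewrite sfrac_div; congr (_ / _).
have dn m (u : linform F L) : den (S := linform_denoms F L) (nseq m u) = linform_val u ^+ m.
  by rewrite /den big_nseq -Monoid.iteropE.
rewrite !den_cat !dn linform_val_x1 linform_val_x2 linform_val_d12 mulrA.
by rewrite /sf_of !rmorphM !rmorphXn.
Qed.

(** Multiplication by x1 ^ N x2 ^ N makes all exponents nonnegative. *)
Lemma laurent_poly (N : nat) S :
  (forall e, S e != 0 -> (`|e.1| <= N%:Z) && (`|e.2| <= N%:Z)) ->
  exists g, lin_acts (nseq N lf_x1 ++ nseq N lf_x2) S = ser_of_poly g.
Proof.
move=> SN; exists (\poly_(q < N.*2.+1) \poly_(p < N.*2.+1) S (p%:Z - N%:Z, q%:Z - N%:Z)).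
apply/funext => -[p q]; rewrite lin_acts_cat lin_acts_nseq_x1 lin_acts_nseq_x2.
have -> : (p, q) - (N%:Z, 0) - (0, N%:Z) = (p - N%:Z, q - N%:Z).
  by congr pair; rewrite /=; lia.
have S0 (a b : int) : ~~ ((`|a| <= N%:Z) && (`|b| <= N%:Z)) -> S (a, b) = 0.
  by move=> h; apply: contraNeq h => /SN.
case: p => p; last by rewrite S0 //; lia.
case: q => q; last by rewrite S0 //; lia.
rewrite /= coef_poly; case: ltnP => hq; last by rewrite coef0 S0 //; lia.
by rewrite coef_poly; case: ltnP => hp //; rewrite S0 //; lia.
Qed.

(** A series that is conical in both senses is a Laurent polynomial. *)
Lemma cone_common (S : int * int -> T) : cone false S -> cone true S ->
  exists N : nat, forall e, S e != 0 -> (`|e.1| <= N%:Z) && (`|e.2| <= N%:Z).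
Proof.
move=> [N SN] [M SM]; exists (N + M)%N => e nz.
by move: (SN _ nz) (SM _ nz); rewrite /=; lia.
Qed.

(** The common multiple of S and X by a power of x1 - x2 - phi1 phi2 is a
    Laurent polynomial; the same fraction then expands to S in one direction
    and to X in the other. *)
Lemma rational_of_common_multiple n S X : cone false S -> cone true X ->
  lin_acts (nseq n lf_d12) S = lin_acts (nseq n lf_d12) X ->
  exists f g (r s t : nat), [/\ iota12 f = S, iota21 f = X
    & f = sf_of g / (sf_of sp_x1 ^ r * sf_of sp_x2 ^ s
             * sf_of (sp_x1 - sp_x2 - sp_const (phi1 * phi2)) ^ t)].
Proof.
move=> cS cX e.
have [N HN] : exists N : nat, forall a, lin_acts (nseq n lf_d12) S a != 0 ->
    (`|a.1| <= N%:Z) && (`|a.2| <= N%:Z).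
  apply: cone_common; first exact: cone_lin_acts.
  by rewrite e; exact: cone_lin_acts.
have [g gE] := laurent_poly HN.
exists (sfrac g (nseq N lf_x1 ++ nseq N lf_x2 ++ nseq n lf_d12)), g, N, N, n.
split; last exact: sfrac_std.
- by apply: (@expandP _ _ false); rewrite // catA lin_acts_cat gE.
by apply: (@expandP _ _ true); rewrite // catA lin_acts_cat -e gE.
Qed.

End Fractions.

(** * Modes and homogeneous components *)

Section VosaModes.
Local Open Scope classical_set_scope.
Variables (F : numFieldType) (L : option nat) (V : vosa F L).
Local Notation Lam := (grassmann F L).
Local Notation T := (odd2 Lam).
Local Notation ax := (vo_axioms V).
Implicit Types (u v w x y : V) (m k : int) (i j : bool).

Lemma odd2_scale1 (s : odd2 V) : odd2_scale 1 s = s.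
Proof.
case: s => a b c d; rewrite -[1]/(oconst 1) /odd2_scale /=.
by rewrite !rmorph1 !rmorph0 !scale0r !scale1r subr0 !addr0.
Qed.

Lemma odd2_scale0l (s : odd2 V) : odd2_scale 0 s = 0.
Proof. by rewrite /odd2_scale /= !rmorph0 !scale0r subr0 !addr0. Qed.

Lemma odd2_scale0r (a : T) : odd2_scale a (0 : odd2 V) = 0.
Proof. by rewrite /odd2_scale /= !scaler0 subr0 !addr0. Qed.

Lemma vo_mode0l k w : vo_mode V k 0 w = 0.
Proof.
by apply: (@addrI _ (vo_mode V k 0 w)); rewrite -(vo_modeDl ax) !addr0.
Qed.

Lemma vo_mode0r k u : vo_mode V k u 0 = 0.
Proof.
by apply: (@addrI _ (vo_mode V k u 0)); rewrite -(vo_modeDr ax) !addr0.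
Qed.

Lemma vo_mode_suml (I : Type) (r : seq I) (f : I -> V) k w :
  vo_mode V k (\sum_(a <- r) f a) w = \sum_(a <- r) vo_mode V k (f a) w.
Proof.
elim: r => [|a r IH]; first by rewrite !big_nil vo_mode0l.
by rewrite !big_cons (vo_modeDl ax) IH.
Qed.

Lemma vo_mode_sumr (I : Type) (r : seq I) (f : I -> V) k u :
  vo_mode V k u (\sum_(a <- r) f a) = \sum_(a <- r) vo_mode V k u (f a).
Proof.
elim: r => [|a r IH]; first by rewrite !big_nil vo_mode0r.
by rewrite !big_cons (vo_modeDr ax) IH.
Qed.

(** Because the products do not involve x0, the exponent of x0 comes from the
    delta function alone; for the iterate the same holds for x1. *)
Lemma ser_act_x1x2 d (s : int * int -> odd2 V) e0 e1 e2 :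
  ser_act d (ser_x1x2 s) (e0, e1, e2) =
  \sum_(a \in [set: int * int]) odd2_scale (d (e0, a.1, a.2)) (s ((e1, e2) - a)).
Proof.
pose h (a : int * int) : int * int * int := (e0, a.1, a.2).
rewrite /ser_act (@fsum_support _ _ _ h).
- apply: eq_fsbigr => -[a1 a2] _; rewrite /h /=.
  by rewrite subrr eqxx.
- by move=> [a1 a2] [b1 b2] [-> ->].
move=> [[a0 a1] a2] no /=.
have [e|] := eqVneq (e0 - a0) 0; last by rewrite odd2_scale0r.
case: (no (a1, a2)); rewrite /h /=; congr (_, _, _).
by apply/eqP; rewrite eq_sym -subr_eq0 e.
Qed.

Lemma ser_act_x0x2 d (s : int * int -> odd2 V) e0 e1 e2 :
  ser_act d (ser_x0x2 s) (e0, e1, e2) =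
  \sum_(a \in [set: int * int]) odd2_scale (d (a.1, e1, a.2)) (s ((e0, e2) - a)).
Proof.
pose h (a : int * int) : int * int * int := (a.1, e1, a.2).
rewrite /ser_act (@fsum_support _ _ _ h).
- apply: eq_fsbigr => -[a1 a2] _; rewrite /h /=.
  by rewrite subrr eqxx.
- by move=> [a1 a2] [b1 b2] [-> ->].
move=> [[a0 a1] a2] no /=.
have [e|] := eqVneq (e1 - a1) 0; last by rewrite odd2_scale0r.
case: (no (a0, a2)); rewrite /h /=; congr (_, _, _).
by apply/eqP; rewrite eq_sym -subr_eq0 e.
Qed.

Lemma vo_hom_wt k i x : vo_hom V k i x -> vo_wt k x.
Proof.
case: i => h.
  by exists 0, x; split; rewrite ?add0r //; exact: (vo_hom0 ax).
by exists x, 0; split; rewrite ?addr0 //; exact: (vo_hom0 ax).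
Qed.

Lemma vo_hom_sgn k i x : vo_hom V k i x -> vo_sgn i x.
Proof.
move=> h; exists (fun k' => if k' == k then x else 0); split.
- by move=> k'; case: eqP => [->|_] //; exact: (vo_hom0 ax).
- apply: (@sub_finite_set _ _ [set k]); last exact: finite_set1.
  by move=> k' /=; case: (k' =P k) => // _; rewrite eqxx.
rewrite (@fsbigTE _ _ _ _ [fset k]%fset).
  by rewrite big_seq_fset1 eqxx.
by move=> k'; rewrite inE => /negPf ->.
Qed.

Lemma vo_decomp x : exists (c : int * bool -> V) (A : {fset int * bool}),
  [/\ forall e, vo_hom V e.1 e.2 (c e), forall e, e \notin A -> c e = 0
    & x = \sum_(e <- A) c e].
Proof.
have [c [[ch cf cE] _]] := vo_direct ax x.
have cA e : e \notin fset_set [set e | c e != 0] -> c e = 0.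
  by rewrite in_fset_set // notin_setE /= => /negP; rewrite negbK => /eqP.
exists c, (fset_set [set e | c e != 0]); split=> //.
by rewrite {1}cE; exact: fsbigTE.
Qed.

(** The eigenvalues of L(0) lie in the ground field; its elements are even
    scalars, which pass through all modes without a sign. *)
Definition fscale (c : F) x : V := (c%:A : Lam) *: x.

(** Each mode is a coefficient of the even or of the odd part of Y, according
    to the parity of k; on scalars, which are even, the rule of signs gives no
    sign. *)
Lemma vo_modeZr k i c u v : vo_sgn i u ->
  vo_mode V k u (fscale c v) = fscale c (vo_mode V k u v).
Proof.
move=> su; have ev := gr_homogC L c.
have [m [mE|mE]] : exists m : int, k = - (m + 1) * 2 \/ k = - (m + 1) * 2 - 1.
  exists (- ((k + 1) %/ 2)%Z - 1).
  by have := modz_ge0 (k + 1) (isT : 2 != 0 :> int);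
     have := ltz_pmod (k + 1) (isT : 0 < 2 :> int);
     have := divz_eq (k + 1) 2; lia.
  have := vo_Y0Zr ax m v su ev; rewrite /vo_Y0 -mE andbF expr0 scale1r.
  exact.
have := vo_Y1Zr ax m v su ev; rewrite /vo_Y1 -mE andbF expr0 scale1r.
exact.
Qed.

Lemma fscaleA (c d : F) x : fscale c (fscale d x) = fscale (c * d) x.
Proof.
exact: (eq_trans (scalerA _ _ x) (congr1 (fun z => z *: x) (scalarM _ c d))).
Qed.

Lemma fscale1 x : fscale 1 x = x.
Proof. by rewrite /fscale !scale1r. Qed.

Lemma fscaleDl (c d : F) x : fscale (c + d) x = fscale c x + fscale d x.
Proof. by rewrite /fscale !scalerDl. Qed.

Lemma fscaleDr (c : F) x y : fscale c (x + y) = fscale c x + fscale c y.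
Proof. by rewrite /fscale scalerDr. Qed.

Lemma fscaleN (c : F) x : fscale (- c) x = - fscale c x.
Proof. by rewrite /fscale !scaleNr. Qed.

Lemma fscale_sum (I : Type) (r : seq I) (f : I -> V) (c : F) :
  fscale c (\sum_(a <- r) f a) = \sum_(a <- r) fscale c (f a).
Proof. exact: scaler_sumr. Qed.

Lemma fscale_int (n : int) x : fscale n%:~R x = x *~ n.
Proof. by rewrite /fscale scaler_int scaler_int. Qed.

Lemma fscale_inj (c : F) x y : c != 0 -> fscale c x = fscale c y -> x = y.
Proof.
move=> c0 e; have := congr1 (fscale c^-1) e.
by rewrite !fscaleA mulVf // !fscale1.
Qed.

Lemma fscale_hom k i c x : vo_hom V k i x -> vo_hom V k i (fscale c x).
Proof.
by move=> /(vo_homZ ax (gr_homogC L c)); rewrite addbF.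
Qed.

Lemma tau_sgn : vo_sgn true (vo_tau V).
Proof. exact: vo_hom_sgn (vo_tau_hom ax). Qed.

Lemma vo_L0E x : vo_L 0 x = fscale 2%:R^-1 (vo_Y1 (vo_tau V) (-2) x).
Proof. by []. Qed.

Lemma vo_LN1E x : vo_L (-1) x = fscale 2%:R^-1 (vo_Y1 (vo_tau V) (-1) x).
Proof. by []. Qed.

Lemma vo_L0_sum (I : Type) (r : seq I) (f : I -> V) :
  vo_L 0 (\sum_(a <- r) f a) = \sum_(a <- r) vo_L 0 (f a).
Proof.
have e : vo_Y1 (vo_tau V) (-2) (\sum_(a <- r) f a) =
    \sum_(a <- r) vo_Y1 (vo_tau V) (-2) (f a) by exact: vo_mode_sumr.
by rewrite vo_L0E e fscale_sum.
Qed.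

(** Applying L(0) to the decomposition of x multiplies the component of
    weight k'/2 by k'/2; as decompositions are unique, the eigenvalue equation
    leaves only the components with k' = k. *)
Lemma vo_L0_eigen k x : vo_L 0 x = fscale (k%:~R / 2%:R) x -> vo_wt k x.
Proof.
move=> ex; have [c [A [ch cA cE]]] := vo_decomp x.
have [d [_ dU]] := vo_direct ax (vo_L 0 x).
pose c1 e := fscale (e.1%:~R / 2%:R) (c e).
pose c2 e := fscale (k%:~R / 2%:R) (c e).
have fin (a : int * bool -> F) : finite_set [set e | fscale (a e) (c e) != 0].
  apply: (@sub_finite_set _ _ [set` A]); last exact: finite_fset.
  move=> e /= nz; apply: contraNT nz => /cA ->.
  by rewrite /fscale scaler0.
have sumA (a : int * bool -> F) :
    \sum_(e \in [set: int * bool]) fscale (a e) (c e) = \sum_(e <- A) fscale (a e) (c e).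
  by apply: fsbigTE => e /cA ->; rewrite /fscale scaler0.
have d1 : d = c1.
  apply: dU; split; first by move=> e; exact/fscale_hom/ch.
    exact: (fin (fun e => e.1%:~R / 2%:R)).
  rewrite /c1 sumA {1}cE vo_L0_sum; apply: eq_bigr => e _.
  exact: (vo_L0 ax (vo_hom_wt (ch e))).
have d2 : d = c2.
  apply: dU; split; first by move=> e; exact/fscale_hom/ch.
    exact: (fin (fun e => k%:~R / 2%:R)).
  by rewrite /c2 sumA ex {1}cE fscale_sum.
have c0 e : e.1 != k -> c e = 0.
  move=> ek; have : c1 e - c2 e = 0 by rewrite -d1 -d2 subrr.
  rewrite /c1 /c2 -fscaleN -fscaleDl -mulrBl -mulrzBr.
  move=> h; apply: (@fscale_inj ((e.1 - k)%:~R / 2%:R)).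
    by rewrite mulf_neq0 // ?invr_neq0 ?pnatr_eq0 // intr_eq0 subr_eq0.
  by rewrite h /fscale scaler0.
exists (c (k, false)), (c (k, true)); split; [exact: (ch (k, false))|exact: (ch (k, true))|].
have cE' : x = \sum_(e \in [set: int * bool]) c e.
  by rewrite {1}cE; apply/esym/fsbigTE.
rewrite {1}cE' (@fsbigTE _ _ _ _ [fset (k, false); (k, true)]%fset).
  by rewrite big_fsetU1 ?big_seq_fset1 // inE xpair_eqE andbF.
move=> [k' b]; rewrite !inE !xpair_eqE => h; apply: c0 => /=.
by apply: contraNneq h => ->; rewrite eqxx; case: b.
Qed.

End VosaModes.

(** * The commutator of L(0) with the even modes *)

Section VosaWeights.
Local Open Scope classical_set_scope.
Variables (F : numFieldType) (L : option nat) (V : vosa F L).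
Local Notation Lam := (grassmann F L).
Local Notation T := (odd2 Lam).
Local Notation ax := (vo_axioms V).
Implicit Types (u v w x y : V) (m k : int) (i j : bool).

Lemma ser_act_delta0 (X : int * int -> T) (s : int * int -> odd2 V) e :
  (forall a, X a = (a == (0, 0))%:R) ->
  \sum_(a \in [set: int * int]) odd2_scale (X a) (s (e - a)) = s e.
Proof.
move=> XE; rewrite (fsum_single (a := (0, 0))).
  by rewrite XE eqxx odd2_scale1 subr0.
by move=> b /negPf h; rewrite XE h odd2_scale0l.
Qed.

Lemma oc1_add (M : zmodType) (s t : odd2 M) : oc1 (s + t) = oc1 s + oc1 t.
Proof. by []. Qed.

Lemma oc1_opp (M : zmodType) (s : odd2 M) : oc1 (- s) = - oc1 s.
Proof. by []. Qed.

Lemma oc1_scale_even (a b : Lam) (s : odd2 V) :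
  oc1 (odd2_scale (Odd2 a 0 0 b) s) = gr_par a *: oc1 s.
Proof. by rewrite /odd2_scale /= scale0r addr0. Qed.

Lemma oc_Y i (b1 b2 : Lam) u m (s : odd2 V) :
  oc (vo_Y i (Odd2 0 b1 b2 0) u m s) = vo_Y0 u m (oc s).
Proof. by rewrite /vo_Y /= scale0r addr0. Qed.

Lemma oc1_Y i (b1 b2 : Lam) u m (s : odd2 V) :
  oc1 (vo_Y i (Odd2 0 b1 b2 0) u m s) =
  (-1) ^+ i *: vo_Y0 u m (oc1 s) + b1 *: vo_Y1 u m (oc s).
Proof. by rewrite /vo_Y /= rmorph0 scale0r add0r. Qed.

Let Y00 u k : vo_Y0 u k (0 : V) = 0. Proof. exact: vo_mode0r. Qed.

Lemma oc1_prod12 j v w m :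
  oc1 (vo_prod12 true j (vo_tau V) v w (-2, m)) =
  vo_Y1 (vo_tau V) (-2) (vo_Y0 v m w).
Proof.
rewrite /vo_prod12 oc1_Y oc1_Y oc_Y /= Y00 !scale0r scaler0 addr0 Y00.
by rewrite scaler0 add0r scale1r.
Qed.

Lemma oc1_prod21 j v w m :
  oc1 (vo_prod21 true j (vo_tau V) v w (-2, m)) *~ (-1) ^+ (true && j) =
  vo_Y0 v m (vo_Y1 (vo_tau V) (-2) w).
Proof.
rewrite /vo_prod21 oc1_Y oc1_Y /= Y00 scale0r scaler0 add0r addr0 scale1r.
case: j; rewrite /= ?expr1 ?expr0 ?mulr1z ?scale1r //.
by rewrite scaleN1r mulrN1z opprK.
Qed.

Lemma oc1_Ylin (s : odd2 V) m w : oc1 (vo_Ylin phi2 s m w) = vo_Y0 (oc1 s) m w.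
Proof.
pose Yw v : odd2 V := oconst (vo_Y0 v m w) + odd2_scale phi2 (oconst (vo_Y1 v m w)).
have e0 v : oc (Yw v) = vo_Y0 v m w by rewrite /Yw /= scale0r addr0.
have e1 v : oc1 (Yw v) = 0.
  by rewrite /Yw /= rmorph0 !scale0r addr0 addr0.
transitivity (oc1 (Yw (oc s) + odd2_scale phi1 (Yw (oc1 s))
  + odd2_scale phi2 (Yw (oc2 s)) + odd2_scale (phi1 * phi2) (Yw (oc12 s)))) => //.
clearbody Yw; rewrite phi12E !oc1_add.
have sc b1 b2 b12 (t : odd2 V) :
    oc1 (odd2_scale (Odd2 0 b1 b2 b12) t) = b1 *: oc t.
  by rewrite /= rmorph0 scale0r add0r.
by rewrite !sc !e0 !e1 !scale0r !addr0 add0r scale1r.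
Qed.

Lemma oc1_iter v w k m :
  oc1 (vo_iter true (vo_tau V) v w (k, m)) =
  vo_Y0 (vo_Y1 (vo_tau V) k v) m w.
Proof.
rewrite /vo_iter oc1_Ylin (_ : phi1 - phi2 = Odd2 0 1 (-1) 0); last first.
  by rewrite -[LHS]/(Odd2 _ _ _ _) !subr0 sub0r.
by rewrite oc1_Y /= Y00 scaler0 add0r scale1r.
Qed.

(** In x2^-1 delta((x1 - x0 - phi1 phi2) / x2) the coefficient of x1 ^ (-2) is
    x2 + x0, apart from phi1 phi2: up to sign x0 ^ k has coefficient
    binz (k - 2) k, which is zero for k > 1. *)
Lemma delta10_L0 (a : int * int) :
  superlin_pow 1 (-1) (-1) (- a.2 - 1) (-2) a.1 =
  Odd2 (((a == (0, 1)) || (a == (1, 0)))%:R : Lam) 0 0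
       (oc12 (superlin_pow 1 (-1) (-1) (- a.2 - 1) (-2) a.1)).
Proof.
rewrite /superlin_pow /=; congr Odd2; case: a => [[k|k] q] /=; last by [].
rewrite !xpair_eqE /lin_pow.
case: (-2 + k%:Z =P - q - 1) => [e|ne]; last first.
  by case: k ne => [|[|k]] ne //=; rewrite (_ : (q == _) = false) //; lia.
rewrite -e exp1rz mul1r.
case: k e => [|[|k]] e.
- by rewrite (_ : q = 1) //; lia.
- have -> : q = 0 by lia.
  by rewrite (_ : binz _ _ = -1) // expr1 mulrN1z opprK.
by rewrite (_ : -2 + k.+2%:Z = k) ?binz_small ?mulr0z //; lia.
Qed.

(** With n = - a.2 - 1, the coefficient of phi1 phi2 is up to sign
    n * binz (n - 1) (n + 1), in front of x0 ^ (n + 1); as n >= - 1, it is zero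
    unless n = - 1. *)
Lemma delta10_phi (a : int * int) :
  oc12 (superlin_pow 1 (-1) (-1) (- a.2 - 1) (-2) a.1) =
  (a == (0, 0))%:R :> Lam.
Proof.
rewrite /superlin_pow /= /lin_pow; case: a => [[k|k] q] /=; last first.
  by rewrite mulr0 mul0rz.
rewrite !xpair_eqE.
case: (-2 + k%:Z =P - q - 1 - 1) => [e|ne]; last first.
  have -> : (Posz k == 0) && (q == 0) = false by lia.
  by rewrite mulr0 mul0rz.
rewrite -e exp1rz mul1r.
case: k e => [|[|k]] e.
- have -> : q = 0 by lia.
  by rewrite (_ : binz _ _ = 1) // expr0 mulr1z mulr1 mulrN1z opprK.
- by rewrite (_ : - q - 1 = 0) ?mulr0z //; lia.
by rewrite (_ : -2 + k.+2%:Z = k) ?binz_small ?mulr0z ?mulr0 ?mul0rz //; lia.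
Qed.

(** The coefficient of phi1, x0^-1 and x1^-2 in the Jacobi identity for tau
    and v.  The operator [vo_Y1 tau m] is the mode 2 L(- m - 2), so this
    reads [2 L(0), Y(v, x)] = x Y(2 L(-1) v, x) + Y(2 L(0) v, x). *)
Lemma tau_commutator j v w m : vo_sgn j v ->
  vo_Y1 (vo_tau V) (-2) (vo_Y0 v m w) - vo_Y0 v m (vo_Y1 (vo_tau V) (-2) w) =
  vo_Y0 (vo_Y1 (vo_tau V) (-1) v) (m - 1) w + vo_Y0 (vo_Y1 (vo_tau V) (-2) v) m w.
Proof.
move=> sv; have := congr1 (@oc1 V) (vo_jacobi ax w (tau_sgn V) sv (-1, -2, m)).
rewrite !ser_act_x1x2 ser_act_x0x2 /delta12 /delta21.
rewrite (ser_act_delta0 (X := fun a => superlin_pow 1 (-1) (-1) (- -1 - 1) a.1 a.2)); last first.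
  by case=> p q; rewrite superlin_pow0.
rewrite (ser_act_delta0 (X := fun a =>
  superlin_pow 1 (-1) 1 (- -1 - 1) a.2 a.1 *~ (-1) ^ (- -1 - 1))); last first.
  by case=> p q; rewrite superlin_pow0 mulr1z /= !xpair_eqE andbC.
rewrite oc1_add oc1_opp.
rewrite (_ : oc1 (_ *~ _) =
  oc1 (vo_prod21 true j (vo_tau V) v w (-2, m)) *~ (-1) ^+ (true && j)); last first.
  by case: (_ && _); rewrite ?expr1 ?expr0 ?mulrN1z ?mulr1z.
rewrite oc1_prod12 oc1_prod21 => ->.
(* The exponent (0, 0) only carries a multiple of phi1 phi2, which drops out of
   the coefficient of phi1. *)
pose A : {fset int * int} := ((0, 0) |` ((0, 1) |` [fset (1, 0)]))%fset.
rewrite (@fsbigTE _ _ _ _ A); last first.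
  move=> a; rewrite !inE !negb_or => /and3P[/negPf a0 /negPf a1 /negPf a2].
  by rewrite /delta10 delta10_L0 delta10_phi a0 a1 a2 /= odd2_scale0l.
have sE (a : int * int) s : oc1 (odd2_scale (delta10 F L (a.1, -2, a.2)) s) =
    (((a == (0, 1)) || (a == (1, 0)))%:R : Lam) *: oc1 (s : odd2 V).
  by rewrite /delta10 delta10_L0 oc1_scale_even; case: (_ || _); rewrite ?rmorph1 ?rmorph0.
have s0 s := etrans (sE (0, 0) s) (scale0r _).
have s1 s := etrans (sE (0, 1) s) (scale1r _).
have s2 s := etrans (sE (1, 0) s) (scale1r _).
rewrite big_fsetU1 ?inE // big_fsetU1 ?inE // big_seq_fset1 !oc1_add.
rewrite s0 s1 s2 add0r; congr (_ + _).
  by rewrite -oc1_iter.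
by rewrite -oc1_iter; congr (oc1 (vo_iter _ _ _ _ _)); congr pair; exact: subr0.
Qed.

Lemma vo_G_G x : vo_G (-1) (vo_G (-1) x) = vo_L (-1) x.
Proof.
have := vo_GG ax (-1) 0 x.
rewrite sub0r addr0 (_ : (-1) ^+ 2 + -1 = 0 :> int) // mulr0 !mul0r scale0r scale0r addr0.
rewrite -mulr2n => e; apply: (@fscale_inj _ _ V 2%:~R); first by rewrite intr_eq0.
by rewrite !fscale_int.
Qed.

(** The derivative property of L(-1), from applying that of G(-1/2) twice. *)
Lemma vo_Y0_LN1 x m w : vo_Y0 (vo_L (-1) x) (m - 1) w = vo_Y0 x m w *~ m.
Proof.
rewrite -vo_G_G (vo_deriv0 ax) (vo_deriv1 ax) subrK.
by [].
Qed.

End VosaWeights.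

(** * Weights, and bounds on exponents *)

Section Bounds.
Local Open Scope classical_set_scope.
Variables (F : numFieldType) (L : option nat) (V : vosa F L).
Local Notation Lam := (grassmann F L).
Local Notation T := (odd2 Lam).
Local Notation ax := (vo_axioms V).
Implicit Types (u v w x y : V) (m k : int) (i j : bool).

Lemma Y0_fscalel c v m w : vo_Y0 (fscale c v) m w = fscale c (vo_Y0 v m w).
Proof. exact: (vo_Y0Zl ax). Qed.

Lemma Y0_fscaler j c v m w : vo_sgn j v ->
  vo_Y0 v m (fscale c w) = fscale c (vo_Y0 v m w).
Proof. by move=> sv; exact: (vo_modeZr _ _ _ sv). Qed.

Lemma vo_L0_fscale k x : vo_wt k x -> vo_L 0 x = fscale (k%:~R / 2%:R) x.
Proof. exact: (vo_L0 ax). Qed.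

Lemma half_weight k l m :
  (k + l + m * 2)%:~R / 2%:R = k%:~R / 2%:R + l%:~R / 2%:R + m%:~R :> F.
Proof. by rewrite !intrD intrM !mulrDl mulfK // pnatr_eq0. Qed.

Lemma vo_L0_Y0 j v w m : vo_sgn j v ->
  vo_L 0 (vo_Y0 v m w) =
  vo_Y0 (vo_L 0 v) m w + vo_Y0 v m (vo_L 0 w) + fscale m%:~R (vo_Y0 v m w).
Proof.
move=> sv; have := tau_commutator w m sv.
move/eqP; rewrite subr_eq => /eqP e.
rewrite fscale_int -vo_Y0_LN1 vo_LN1E !vo_L0E (Y0_fscaler _ _ _ sv) !Y0_fscalel e.
rewrite !fscaleDr -addrA [LHS]addrC.
by [].
Qed.

Lemma vo_Y0_wt k l i v w m : vo_hom V k i v -> vo_wt l w ->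
  vo_wt (k + l + m * 2) (vo_Y0 v m w).
Proof.
move=> hv hw; apply: vo_L0_eigen; have sv := vo_hom_sgn hv.
rewrite (vo_L0_Y0 _ _ sv) (vo_L0_fscale (vo_hom_wt hv)) (vo_L0_fscale hw).
rewrite (Y0_fscaler _ _ _ sv) Y0_fscalel.
have addf (a b c : F) y : fscale a y + fscale b y + fscale c y =
    fscale (a + b + c) y by rewrite !fscaleDl.
by rewrite addf -half_weight.
Qed.

Lemma int_bounded (A : set int) : finite_set A ->
  exists M : nat, forall k, A k -> k <= M%:Z.
Proof.
move=> /finite_seqP[s ->]; exists (\sum_(k <- s) `|k|)%N => k /= ks.
rewrite (big_rem k) //=; lia.
Qed.

Lemma dual_vanish (v' : graded_dual V) :
  exists M : nat, forall k x, M%:Z < k -> vo_wt k x -> v' x = 0.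
Proof.
have [M MA] := int_bounded (gd_finite v'); exists M => k x Mk wx.
apply: contrapT => nz; have := MA k; rewrite leNgt Mk => H; apply/notF/H.
by exists x => //; apply/eqP.
Qed.

(** On V_(l/2) the coefficient of x ^ p maps to weight l/2 + wt u + p.  For p
    large this exceeds the weights on which v' is nonzero, uniformly in l
    because l is bounded below. *)
Lemma dual_Y0_vanish (v' : graded_dual V) u :
  exists N : nat, forall p x, N%:Z < p -> v' (vo_Y0 u p x) = 0.
Proof.
have [M MP] := dual_vanish v'; have [N0 NP] := vo_positive ax.
have [c [A [ch cA uE]]] := vo_decomp u.
exists (M + `|N0| + \sum_(e <- A) `|e.1|)%N => p x hp.
have [d [B [dh dB xE]]] := vo_decomp x.
have -> : vo_Y0 u p x = \sum_(e <- A) \sum_(f <- B) vo_Y0 (c e) p (d f).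
  rewrite uE [LHS]vo_mode_suml; apply: eq_bigr => e _.
  by rewrite xE; exact: vo_mode_sumr.
rewrite linear_sum big_seq big1 // => e eA; rewrite linear_sum big1 // => f _.
have [fN|fN] := ltP f.1 N0.
  have -> : d f = 0 by exact: (NP _ fN _ (vo_hom_wt (dh f))).
  by rewrite [vo_Y0 _ _ _]vo_mode0r linear0.
apply: (MP _ _ _ (vo_Y0_wt p (ch e) (vo_hom_wt (dh f)))).
have he : (`|e.1| <= \sum_(e <- A) `|e.1|)%N by rewrite (big_rem e) //= leq_addr.
move: hp he fN; move: (\sum_(e <- A) _)%N (e.1) (f.1) => S a b; lia.
Qed.

Lemma dual_Y1_vanish (v' : graded_dual V) u :
  exists N : nat, forall p x, N%:Z < p -> v' (vo_Y1 u p x) = 0.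
Proof.
have [N NP] := dual_Y0_vanish v' (vo_G (-1) u); exists N => p x /NP h.
by rewrite -(vo_deriv0 ax).
Qed.

Lemma vo_Y_truncation v w :
  exists N : nat, forall q, q < - N%:Z -> vo_Y0 v q w = 0 /\ vo_Y1 v q w = 0.
Proof.
have [N NP] := vo_truncation ax v w; exists (`|N| + 1)%N => q hq.
by split; apply: NP; lia.
Qed.

Lemma vo_Y0r i phi u m : vo_Y i phi u m 0 = 0.
Proof.
rewrite /vo_Y /odd2_op /=.
have -> : vo_Y0 u m 0 = 0 by exact: vo_mode0r.
have -> : vo_Y1 u m 0 = 0 by exact: vo_mode0r.
by rewrite !scaler0 odd2_scale0r addr0.
Qed.

Lemma vo_Y_oconst0 i phi u m w : vo_Y0 u m w = 0 -> vo_Y1 u m w = 0 ->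
  vo_Y i phi u m (oconst w) = 0.
Proof.
move=> e0 e1; rewrite /vo_Y /odd2_op /= e0 e1.
have -> : vo_Y0 u m 0 = 0 by exact: vo_mode0r.
have -> : vo_Y1 u m 0 = 0 by exact: vo_mode0r.
by rewrite !scaler0 odd2_scale0r addr0.
Qed.

Definition pair_odd (v' : graded_dual V) (s : odd2 V) : T :=
  odd2_map (fun v => v' v : Lam) s.

Lemma pair_oddD (v' : graded_dual V) s t : pair_odd v' (s + t) = pair_odd v' s + pair_odd v' t.
Proof. by rewrite /pair_odd /odd2_map /= !linearD. Qed.

Lemma pair_odd_scale (v' : graded_dual V) (a : T) s :
  pair_odd v' (odd2_scale a s) = a * pair_odd v' s.
Proof.
have lz (c : Lam) x : v' (c *: x) = c * v' x :> Lam by rewrite linearZ.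
apply: odd2_eq => /=.
- exact: lz.
- by rewrite linearD !lz.
- by rewrite linearD !lz.
by rewrite !linearD linearN !lz.
Qed.

Lemma pair_odd0 (v' : graded_dual V) : pair_odd v' 0 = 0.
Proof. by rewrite /pair_odd /odd2_map /= !linear0. Qed.

Lemma pair_Y_vanish (v' : graded_dual V) i phi u m s :
  (forall x, v' (vo_Y0 u m x) = 0) -> (forall x, v' (vo_Y1 u m x) = 0) ->
  pair_odd v' (vo_Y i phi u m s) = 0.
Proof.
move=> h0 h1; rewrite /vo_Y pair_oddD pair_odd_scale.
have op0 b (f : V -> V) t : (forall x, v' (f x) = 0) -> pair_odd v' (odd2_op b f t) = 0.
  by move=> h; rewrite /pair_odd /odd2_op /odd2_map /= !linearZ !h /= scaler0.
by rewrite !op0 // mulr0 addr0.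
Qed.

(** The outer operator bounds the positive powers of its variable through v',
    the inner one the negative powers of its variable through truncation. *)
Lemma pair_YY_vanish (v' : graded_dual V) i j phi psi u v w :
  exists N : nat, forall p q, (N%:Z < p) || (q < - N%:Z) ->
  pair_odd v' (vo_Y i phi u p (vo_Y j psi v q (oconst w))) = 0.
Proof.
have [N0 h0] := dual_Y0_vanish v' u; have [N1 h1] := dual_Y1_vanish v' u.
have [N2 h2] := vo_Y_truncation v w.
exists (N0 + N1 + N2)%N => p q /orP[hp|hq].
  by apply: pair_Y_vanish => x; [apply: h0|apply: h1]; lia.
have [|e0 e1] := h2 q; first by lia.
by rewrite vo_Y_oconst0 // vo_Y0r pair_odd0.
Qed.

End Bounds.

Lemma mulrz_signK (A : zmodType) (z : A) (n : nat) :
  z *~ (-1) ^+ n *~ (-1) ^+ n = z.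
Proof. by rewrite -mulrzA -expr2 sqrr_sign mulr1z. Qed.

(** * Weak supercommutativity and rationality *)

Section WeakCommutativity.
Local Open Scope classical_set_scope.
Variables (F : numFieldType) (L : option nat) (V : vosa F L).
Local Notation Lam := (grassmann F L).
Local Notation T := (odd2 Lam).
Local Notation ax := (vo_axioms V).
Implicit Types (u v w x y : V) (m k : int) (i j : bool).

Lemma spow_nat_finsupp sw (b c d : Lam) (n : nat) :
  finsupp_fam (spow sw b c d n).
Proof.
have h e : spow sw b c d n e != 0 ->
    [&& -1 <= (flip sw e).1, (flip sw e).1 <= n%:Z, 0 <= (flip sw e).2 & (flip sw e).2 <= n%:Z].
  apply: contraNT => h; rewrite /spow.
  have [h1|h1] := ltP n%:Z (flip sw e).2; first by rewrite superlin_pow_nat_small.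
  have [h2|h2] := ltP (flip sw e).2 0.
    by rewrite superlin_pow_small // h2 orbT.
  have [h3|h3] := ltP n%:Z (flip sw e).1.
    by rewrite superlin_pow_small // h3.
  rewrite superlin_pow_low //; lia.
by case: sw h => h; apply: finsupp_box => e /h; rewrite /flip /= => H;
  apply/and4P; move/and4P: H => [h1 h2 h3 h4]; split; eassumption.
Qed.

Lemma pair_fsum (v' : graded_dual V) (X : int * int -> T) (s : int * int -> odd2 V) e :
  finsupp_fam X ->
  pair_odd v' (\sum_(a \in [set: int * int]) odd2_scale (X a) (s (e - a))) =
  conv X (fun e => pair_odd v' (s e)) e.
Proof.
move=> [A XA].
rewrite (fsum_morph (f := pair_odd v') (pair_odd0 v') (pair_oddD v')); last first.
  by exists A => a /XA ->; rewrite odd2_scale0l.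
by apply: eq_fsbigr => a _; exact: pair_odd_scale.
Qed.

Lemma vo_Ylin0 m w : vo_Ylin (phi2 : T) (0 : odd2 V) m w = 0.
Proof.
rewrite /vo_Ylin /=.
have -> : vo_Y0 (0 : V) m w = 0 by exact: vo_mode0l.
have -> : vo_Y1 (0 : V) m w = 0 by exact: vo_mode0l.
by rewrite !odd2_scale0r !addr0 !odd2_scale0r !addr0.
Qed.

(** The delta function contributes nonnegative powers of x0 only, so that
    Y(u, (x0, phi1 - phi2)) v is evaluated at exponents at most - n - 1. *)
Lemma iter_vanish i u v w : exists N : nat, forall (n : nat) e1 e2, (N <= n)%N ->
  ser_act (@delta10 F L) (ser_x0x2 (vo_iter i u v w)) (- n%:Z - 1, e1, e2) = 0.
Proof.
have [N NP] := vo_Y_truncation u v; exists N => n e1 e2 Nn.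
rewrite ser_act_x0x2; apply: fsbig1 => -[a1 a2] _.
rewrite /delta10 /=.
have [h|h] := ltP a1 0.
  by rewrite superlin_pow_small ?h ?orbT // odd2_scale0l.
rewrite /vo_iter /=.
have [|e0 e1'] := NP (- n%:Z - 1 - a1); first by lia.
by rewrite vo_Y_oconst0 // vo_Ylin0 odd2_scale0r.
Qed.

Lemma conv_mulz (R : nzRingType) (X S : int * int -> R) (c : int) e :
  finsupp_fam X -> conv (fun a => X a *~ c) S e = conv X S e *~ c.
Proof.
move=> [A XA]; rewrite /conv.
rewrite (fsum_morph (f := fun z => z *~ c)) ?mul0rz //; last first.
- by exists A => a /XA ->; rewrite mul0r.
- by move=> x y; exact: mulrzDl.
by apply: eq_fsbigr => a _; rewrite mulrzAl.
Qed.

Lemma pair_odd_sign (v' : graded_dual V) s (b : bool) :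
  pair_odd v' (s *~ (-1) ^+ b) = pair_odd v' s *~ (-1) ^+ b.
Proof.
case: b; rewrite ?expr1 ?expr0 ?mulr1z // !mulrN1z.
by apply: (@addrI _ (pair_odd v' s)); rewrite -pair_oddD !subrr pair_odd0.
Qed.

(** The coefficient of x0 ^ (- n - 1) in the Jacobi identity, paired with v'.
    The factor (-1) ^ n comes from the denominator - x0 of the second delta
    function. *)
Lemma weak_supercommutativity (v' : graded_dual V) i j u v w :
  vo_sgn i u -> vo_sgn j v -> exists n : nat, forall e,
  conv (spow false 1 (-1) (-1) n) (pairing v' (vo_prod12 i j u v w)) e =
  conv (spow true 1 (-1) 1 n) (pairing v' (vo_prod21 i j u v w)) e
    *~ (-1) ^+ n *~ (-1) ^+ (i && j).
Proof.
move=> su sv; have [n nP] := iter_vanish i u v w; exists n => -[e1 e2].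
have en : - (- n%:Z - 1) - 1 = n%:Z by lia.
have := vo_jacobi ax w su sv (- n%:Z - 1, e1, e2).
rewrite nP // !ser_act_x1x2 /delta12 /delta21 en.
move/eqP; rewrite subr_eq0 => /eqP J.
have fs1 := spow_nat_finsupp false (1 : Lam) (-1) (-1) n.
have fs2 := spow_nat_finsupp true (1 : Lam) (-1) 1 n.
have fs3 : finsupp_fam (fun a => spow true (1 : Lam) (-1) 1 n a *~ (-1) ^+ n).
  by case: fs2 => A h; exists A => a /h ->; rewrite mul0rz.
have E1 := pair_fsum v' (vo_prod12 i j u v w) (e1, e2) fs1.
have E2 := pair_fsum v' (vo_prod21 i j u v w) (e1, e2) fs3.
apply: (eq_trans (esym E1)).
apply: (eq_trans (congr1 (pair_odd v') J)).
apply: (eq_trans (pair_odd_sign _ _ _)).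
apply: (congr1 (fun z => z *~ (-1) ^+ (i && j))).
apply: (eq_trans E2).
exact: conv_mulz.
Qed.

Lemma lin_acts_mulz l (S : int * int -> T) (c : int) :
  lin_acts l (fun e => S e *~ c) = fun e => lin_acts l S e *~ c.
Proof.
elim: l => [//|t l IH]; rewrite !lin_acts_cons IH; apply/funext => e.
rewrite /lin_act; case: (val t) => [[a1 a2] a12]; rewrite /lin.
by rewrite !mulrzAr -!mulrzDl.
Qed.

Lemma cone_mulz sw (S : int * int -> T) (c : int) :
  cone sw S -> cone sw (fun e => S e *~ c).
Proof.
move=> [N SN]; exists N => e nz; apply: SN.
by apply: contraNneq nz => ->; rewrite mul0rz.
Qed.

(** Supercommutativity is built into the choice of f: its two expansions are
    the two orders of the product. *)
Lemma products_rational (v' : graded_dual V) i j u v w :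
  vo_sgn i u -> vo_sgn j v ->
  exists (f : superfun F L) (g : superpoly F L) (r s t : nat),
    [/\ iota12 f = pairing v' (vo_prod12 i j u v w),
        iota21 f = (fun e =>
          pairing v' (vo_prod21 i j u v w) e *~ (-1) ^+ (i && j))
      & f = sf_of g / (sf_of sp_x1 ^ r * sf_of sp_x2 ^ s
              * sf_of (sp_x1 - sp_x2 - sp_const (phi1 * phi2)) ^ t)].
Proof.
move=> su sv.
set P12 := pairing v' (vo_prod12 i j u v w).
set P21 := pairing v' (vo_prod21 i j u v w).
have c12 : cone false P12.
  have [N PN] := pair_YY_vanish v' i j phi1 phi2 u v w.
  exists N => -[p q] /=; apply: contraNT => nb.
  by apply/eqP/(PN p q); move: nb; lia.
have c21 : cone true P21.
  have [N PN] := pair_YY_vanish v' j i phi2 phi1 v u w.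
  exists N => -[p q] /=; apply: contraNT => nb.
  by apply/eqP/(PN q p); move: nb; lia.
have [n weak] := weak_supercommutativity v' w su sv.
have b1 : gr_body (1 : Lam) != 0.
  by rewrite (rmorph1 (@gr_body F L)) oner_eq0.
have e12 : conv (spow false 1 (-1) (-1) n) P12 = lin_acts (nseq n (lf_d12 F L)) P12.
  exact: (@conv_spow _ _ false (lf_d12 F L) n P12 b1 c12).
have e21 : conv (spow true 1 (-1) 1 n) P21 = lin_acts (nseq n (lf_d21 F L)) P21.
  exact: (@conv_spow _ _ true (lf_d21 F L) n P21 b1 c21).
apply: (@rational_of_common_multiple _ _ n); [exact: c12|exact: cone_mulz|].
apply: (eq_trans (esym e12)); apply/funext => e.
apply: (eq_trans (weak e)).
have e3 := etrans (congr1 (fun z => z e) e21) (lin_acts_nseq_d21 n P21 e).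
have eQ := congr1 (fun z => z e)
  (lin_acts_mulz (nseq n (lf_d12 F L)) P21 ((-1) ^+ (i && j))).
apply: etrans (esym eQ); apply: (congr1 (fun z => z *~ (-1) ^+ (i && j))).
(* The two signs (-1) ^ n, from the delta function and from replacing
   x2 - x1 + phi1 phi2 by its opposite, cancel. *)
apply: (etrans (congr1 (fun z => z *~ (-1) ^+ n) e3)).
exact: mulrz_signK.
Qed.

End WeakCommutativity.

Theorem proposition9p1 (R : realType) (L : option nat) (V : vosa R[i] L)
    (u v w : V) (i j : bool) (v' : graded_dual V) :
  vo_sgn i u -> vo_sgn j v ->
  let P12 := pairing v' (vo_prod12 i j u v w) in
  let P21 := pairing v' (vo_prod21 i j u v w) in
  (exists N : int, forall p q : int,
     (N < p) || (q < - N) -> P12 (p, q) = 0) /\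
  exists f : superfun R[i] L,
    [/\ iota12 f = P12,
        forall f' : superfun R[i] L, iota12 f' = P12 -> f' = f,
        exists (g : superpoly R[i] L) (r s t : int),
          f = sf_of g / (sf_of sp_x1 ^ r * sf_of sp_x2 ^ s
                * sf_of (sp_x1 - sp_x2 - sp_const (phi1 * phi2)) ^ t),
        P21 = (fun e => iota21 f e *~ (-1) ^+ (i && j))
      & iota12V P12 = iota21V P21 *~ (-1) ^+ (i && j)].
Proof.
move=> su sv P12 P21.
split.
  have [N PN] := pair_YY_vanish v' i j phi1 phi2 u v w.
  by exists N%:Z => p q; exact: PN.
have [f [g [r [s [t [f12 f21 fE]]]]]] := products_rational v' w su sv.
have uniq12 f' : iota12 f' = P12 -> f' = f.
  by move=> e; apply: (@expand_inj _ _ false); exact: etrans e (esym f12).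
have P21E : P21 = fun e => iota21 f e *~ (-1) ^+ (i && j).
  by apply/funext => e; rewrite f21 mulrz_signK.
exists f; split=> //; first by exists g, r%:Z, s%:Z, t%:Z.
have -> : iota12V P12 = f.
  apply: uniq12; rewrite /iota12V.
  by case: xgetP => [f' _ //|/(_ f)]; case.
have -> : iota21V P21 = f *~ (-1) ^+ (i && j).
  have e21 : iota21 (f *~ (-1) ^+ (i && j)) = P21.
    by rewrite P21E; exact: (expandZsign true).
  rewrite /iota21V; case: xgetP => [f' _ /= e|/(_ (f *~ (-1) ^+ (i && j)))];
    last by case.
  by apply: (@expand_inj _ _ true); exact: etrans e (esym e21).
by rewrite mulrz_signK.
Qed.
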